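(* Let $\kappa\ge1$ and $n_{\max}\ge1$ be integers and let $\chi>1$ be real. Consider the class of all instances (with any capacity $C\ge n_{\max}$) in which all job lengths lie in $[1,\kappa]$ and the maximum number of instances demanded by a job is $n_{\max}$. On this class the dynamic-program-based mechanism $\Gamma_D$ with parameter $\chi$ has competitive ratio exactly $$n_{\max}\cdot\frac{\chi}{1-\chi^{-1/\kappa}}+1 .$$ That is, $\Gamma_D$ is $c$-competitive on this class for $c$ equal to this number, and it is not $c$-competitive on this class for any smaller $c$.
   Context: Setting. A cloud provider has $C\in\mathbb{N}$ identical instances at every time $t\in[0,\infty)$. A job sequence $\theta$ is a finite list of jobs $\theta_i=(r_i,d_i,n_i,l_i,v_i)$: release time $r_i\ge0$, deadline $d_i$, required number of instances $n_i$ (positive integer, $n_i\le n_{\max}\le C$), length $l_i\in[1,\kappa]$ ($\kappa$ a positive integer), value $v_i>0$. Nothing is known about job $i$ before time $r_i$. An allocation is feasible if at every time the total number of allocated instances is at most $C$. Job $i$ is completed if it receives at least $n_i$ instances continuously for $l_i$ time units between $r_i$ and $d_i$; an interrupted job loses all its progress but may be restarted from scratch. The social welfare of an allocation is the sum of the values of the completed jobs. $OPT(\theta)$ is the maximum social welfare of a feasible allocation computed offline with full knowledge of $\theta$; $W(M,\theta)$ is the social welfare obtained by the online mechanism $M$ on $\theta$ (with truthful reports). Competitiveness. $M$ is $c$-competitive on a class of instances if no instance in the class satisfies $c\cdot W(M,\theta)<OPT(\theta)$. The competitive ratio of $M$ on the class is the least such $c$ ($\infty$ if there is none). Mechanism $\Gamma_D$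 with parameter $\chi>1$. At time $t$ let $\delta_i\in[0,1]$ be the fraction of $l_i$ for which job $i$ has been continuously processed up to $t$ in its current uninterrupted run ($\delta_i=0$ if it is not running). Job $i$ is feasible at $t$ if $r_i\le t$, $d_i-t\ge(1-\delta_i)l_i$, and it has not been completed. A time is critical if a job is released or a running job is completed at that time. At every critical time $t$, in increasing order: let $J_F$ be the set of feasible jobs and set $v_i'=v_i\chi^{\delta_i}$ for $i\in J_F$; choose (by the knapsack dynamic program) a subset $S_t\subseteq J_F$ with $\sum_{i\in S_t}n_i\le C$ maximizing $\sum_{i\in S_t}v_i'$ (ties broken by an arbitrary fixed rule), and run $S_t$ (job $i$ on $n_i$ instances) until the next critical time; running jobs not in $S_t$ are interrupted. (Each completed job pays its critical value, the minimum reported value for which it would be completed; payments do not affect social welfare.) *)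

(* Defs.v *)
From HB Require Import structures.
From mathcomp Require Import all_boot all_order all_algebra.
From mathcomp Require Import boolp classical_sets reals exp.

Set Implicit Arguments.
Unset Strict Implicit.
Unset Printing Implicit Defensive.

Import Order.TTheory GRing.Theory Num.Theory.
Local Open Scope ring_scope.

Record job (R : realType) := Job {
  release : R;
  deadline : R;
  demand : nat;
  len : R;
  value : R }.

Definition job_at (R : realType) (theta : seq (job R)) (i : 'I_(size theta)) :
  job R := tnth (in_tuple theta) i.

(* [a t i] is the number of instances given to job [i] at time [t]. *)
Definition allocation (R : realType) (theta : seq (job R)) :=
  R -> 'I_(size theta) -> nat.

Definition feasible_allocation (R : realType) (C : nat) (theta : seq (job R))
    (a : allocation theta) : Prop :=
  forall t : R, 0 <= t -> (\sum_i a t i <= C)%N.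

(* The processing interval is half-open, so that a job may start at the instant
   another one ends. *)
Definition completed_in (R : realType) (theta : seq (job R))
    (a : allocation theta) (i : 'I_(size theta)) : Prop :=
  exists s : R,
    [/\ release (job_at i) <= s, s + len (job_at i) <= deadline (job_at i) &
        forall t, s <= t < s + len (job_at i) ->
          (demand (job_at i) <= a t i)%N].

Definition welfare (R : realType) (theta : seq (job R))
    (a : allocation theta) : R :=
  \sum_(i | `[< completed_in a i >]) value (job_at i).

(* A supremum over finitely many values, hence a maximum. *)
Definition OPT (R : realType) (C : nat) (theta : seq (job R)) : R :=
  sup [set w | exists2 a : allocation theta,
                 feasible_allocation C a & w = welfare a]%classic.

Definition mechanism (R : realType) :=
  forall (C : nat) (theta : seq (job R)), allocation theta.

Definition instance_class (R : realType) := nat -> seq (job R) -> Prop.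

Definition competitive (R : realType) (M : mechanism R) (K : instance_class R)
    (c : R) : Prop :=
  ~ exists C theta, K C theta /\ c * welfare (M C theta) < OPT C theta.

Definition has_competitive_ratio (R : realType) (M : mechanism R)
    (K : instance_class R) (c : R) : Prop :=
  competitive M K c /\ forall c' : R, c' < c -> ~ competitive M K c'.

Definition valid_job (R : realType) (kappa : nat) (j : job R) : Prop :=
  [/\ 0 <= release j, (0 < demand j)%N, 1 <= len j <= kappa%:R & 0 < value j].

Definition bounded_instances (R : realType) (kappa nmax : nat) :
    instance_class R := fun C theta =>
  [/\ (nmax <= C)%N,
      forall i : 'I_(size theta), valid_job kappa (job_at i) &
      (\max_(i < size theta) demand (job_at i))%N = nmax].

(* What the knapsack solver is told about a feasible job [i]: the job, its
   progress fraction delta_i and its boosted value v_i'. *)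
Record item (R : realType) := Item {
  item_job : job R;
  item_progress : R;
  item_value : R }.

(* A selection rule sees the capacity, the current time and the items, and
   returns a bit mask selecting some of them; in particular it knows nothing of
   the jobs still to be released. *)
Definition selection_rule (R : realType) := nat -> R -> seq (item R) -> bitseq.

(* Each rule satisfying this predicate is one way of breaking ties. *)
Definition knapsack_optimal (R : realType) (rule : selection_rule R) : Prop :=
  forall (C : nat) (t : R) (s : seq (item R)),
    let fits m := (\sum_(x <- mask m s) demand (item_job x) <= C)%N in
    let total m := \sum_(x <- mask m s) item_value x in
    fits (rule C t s) /\ forall m, fits m -> total m <= total (rule C t s).

Section GammaD.
Variables (R : realType) (chi : R) (rule : selection_rule R).
Variables (C : nat) (theta : seq (job R)).
Local Notation I := 'I_(size theta).

(* The situation just after the critical time [clock] has been processed: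
   [start i = Some s] when [i] is running, without interruption since [s]. *)
Record state := State {
  clock : R;
  start : I -> option R;
  finished : {set I} }.

(* Release times are nonnegative, so [-1] precedes every critical time. *)
Definition init_state : state := State (-1) (fun=> None) finset.set0.

Definition progress (st : state) (t : R) (i : I) : R :=
  if start st i is Some s then (t - s) / len (job_at i) else 0.

Definition critical_candidates (st : state) : seq R :=
  [seq release (job_at i) | i <- enum I] ++
  pmap (fun i => omap (fun s => s + len (job_at i)) (start st i)) (enum I).

Definition next_critical (st : state) : option R :=
  ohead (sort <=%R [seq t <- critical_candidates st | clock st < t]).

Definition finished_at (st : state) (t : R) : {set I} :=
  finished st :|: [set i | 1 <= progress st t i].

Definition feasible_jobs (st : state) (t : R) : {set I} :=
  [set i | [&& release (job_at i) <= t,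
     (1 - progress st t i) * len (job_at i) <= deadline (job_at i) - t &
     i \notin finished_at st t]].

Definition item_of (st : state) (t : R) (i : I) : item R :=
  let delta := progress st t i in
  Item (job_at i) delta (value (job_at i) * chi `^ delta).

Definition selected (st : state) (t : R) : {set I} :=
  let JF := enum (feasible_jobs st t) in
  [set i in mask (rule C t [seq item_of st t i | i <- JF]) JF].

Definition process (st : state) (t : R) : state :=
  State t
    (fun i => if i \in selected st t then Some (odflt t (start st i)) else None)
    (finished_at st t).

Definition step (st : state) : state :=
  if next_critical st is Some t then process st t else st.

Definition in_force (st : state) (t : R) : bool :=
  (clock st <= t) && (if next_critical st is Some u then t < u else true).

Definition run_at (t : R) (i : I) : Prop :=
  exists k, let st := iter k step init_state in
    in_force st t && isSome (start st i).

Definition GammaD_allocation : allocation theta :=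
  fun t i => if `[< run_at t i >] then demand (job_at i) else 0%N.

End GammaD.

Definition GammaD (R : realType) (chi : R) (rule : selection_rule R) :
  mechanism R := fun C theta => GammaD_allocation chi rule C (theta := theta).

(* Main.v *)
(** The upper bound charges values to the total boosted value [V(t)] of the jobs
that Gamma_D runs. Put [x = chi^(1/kappa)]. Between critical times [V] grows at
rate at least [x], and at a critical time it loses only the completed jobs, each
boosted by exactly [chi]; hence [V(t)] is at most the sum over the jobs [j] that
Gamma_D completes at a time [tau_j > t] of [chi v_j x^(t - tau_j)]. A feasible
job [i] that is not selected could replace cheap running jobs, so by averaging
[C v_i <= n_i n_max V]. A job [i] missed by Gamma_D but started at [s_i] offline
therefore costs at most [n_i n_max / C] times the above sum at [t = s_i]. Offline
starts within a unit window belong to jobs running simultaneously, so they use at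
most [C] instances; the charges received by a job [j] thus form a geometric series
bounded by [n_max chi v_j / (1 - 1/x)]. The jobs completed on both sides account
for the summand [1].

For the lower bound, with [C = n_max], a chain of jobs occupying all instances,
each preempting the previous one, grows like [x^t]; meanwhile unit jobs on a single
instance, of value just below the boosted value of the running job, arrive one
after the other, always too late, and are all completed offline. *)

Require Import Defs.
From HB Require Import structures.
From mathcomp Require Import all_boot all_order all_algebra.
From mathcomp Require Import boolp classical_sets reals exp.
From mathcomp Require Import ring lra zify.

Set Implicit Arguments.
Unset Strict Implicit.
Unset Printing Implicit Defensive.

Import Order.TTheory GRing.Theory Num.Theory.
Local Open Scope ring_scope.

(** * Exchange and discounting *)

Section Combinatorics.
Variables (R : realFieldType) (I : finType).
Implicit Types (S T : {set I}) (w : I -> R).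

Lemma exists_ge_average S w : (0 < #|S|)%N ->
  exists2 j, j \in S & \sum_(i in S) w i <= #|S|%:R * w j.
Proof.
case/card_gt0P => i0 i0S.
have [j jS jmax] : exists2 j, j \in S & forall i, i \in S -> w i <= w j.
  by case: (@Order.TotalTheory.arg_maxP _ R I i0 [in S] w i0S) => j jS jmax; exists j.
exists j => //.
rewrite mulr_natl -sumr_const; exact: ler_sum.
Qed.

(** Discarding an element of at least average weight never raises the average. The averages are
    compared after cross-multiplication, which covers the empty set too. *)
Lemma light_subset S w k : (k <= #|S|)%N ->
  exists T : {set I}, [/\ T \subset S, #|T| = k &
    #|S|%:R * \sum_(j in T) w j <= k%:R * \sum_(j in S) w j].
Proof.
move=> kS; rewrite -(subKn kS); elim: (#|S| - k)%N => [|d [T [TS cT leT]]].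
  by exists S; rewrite subn0.
(* Here [d] may have reached [#|S|]: the truncated difference then stays 0 and the empty set serves
   again. *)
have [T0|Tgt0] := posnP #|T|.
  exists T; split=> //; first by lia.
  by rewrite (_ : (_ - d.+1 = #|S| - d)%N) //; lia.
have [j jT avg] := exists_ge_average w Tgt0.
exists (T :\ j); split.
- exact: fintype.subset_trans (finset.subsetDl _ _) TS.
- by move: (cardsD1 j T); rewrite jT cT; lia.
move: leT avg; rewrite (big_setD1 j jT) /= -cT.
rewrite (_ : (#|S| - d.+1 = #|T|.-1)%N); last by lia.
case: #|T| Tgt0 => // t _ /=; rewrite -natr1.
set a := \sum_(i in T :\ j) w i; set W := \sum_(i in S) w i.
have t0 : 0 <= t%:R :> R by [].
have s0 : 0 <= #|S|%:R :> R by [].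
move: t%:R t0 #|S|%:R s0 => {}t t0 s s0 h1 h2.
rewrite -(ler_pM2l (x := t + 1)); last by lra.
have h3 : 0 <= s * (t * w j - a) by apply: mulr_ge0 => //; lra.
have h4 : 0 <= t * ((t + 1) * W - s * (w j + a)) by apply: mulr_ge0 => //; lra.
by nra.
Qed.

(* Evicting the k cheapest jobs of S, for the least k that certainly makes room
   for i, costs at most the average value of k jobs of S; and S has at least
   (used capacity)/m jobs. *)
Lemma exchange_bound (S : {set I}) (i : I) (dem : I -> nat) w (C m : nat) :
  (m <= C)%N -> (0 < dem i <= m)%N ->
  (forall j, j \in S -> 0 < dem j <= m)%N -> (\sum_(j in S) dem j <= C)%N ->
  0 < w i -> (forall j, j \in S -> 0 <= w j) ->
  (forall T : {set I}, T \subset S -> (dem i + \sum_(j in T) dem j <= C)%N ->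
     w i + \sum_(j in T) w j <= \sum_(j in S) w j) ->
  C%:R * w i <= (dem i)%:R * m%:R * \sum_(j in S) w j.
Proof.
move=> mC /andP[d0 dm] demS SC wi0 w0 opt.
(* [f] is the free capacity; [i] does not fit into it, as adding [i] to [S] would contradict
   optimality. *)
set f := (C - \sum_(j in S) dem j)%N.
have fd : (f < dem i)%N.
  rewrite ltnNge; apply/negP => df.
  have := opt S (subxx _); rewrite gerDr leNgt wi0 /= => h.
  by suff: false by []; apply: h; rewrite /f in df; lia.
(* Each evicted job frees at least one instance, so [dem i - f] evictions suffice; if [S] has fewer
   jobs, all of them go. *)
set k := minn (dem i - f) #|S|.
have kS : (k <= #|S|)%N by rewrite geq_minr.
have [T [TS cT leT]] := light_subset w kS.
have ST : w i <= \sum_(j in T) w j.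
  have := opt (S :\: T) (finset.subsetDl _ _).
  rewrite (big_setID T (A := S)) /= (finset.setIidPr TS) lerD2r; apply.
  have TD : (\sum_(j in S) dem j
      = \sum_(j in T) dem j + \sum_(j in S :\: T) dem j)%N.
    by rewrite (big_setID T) /= (finset.setIidPr TS).
  have [kE|kE] : k = (dem i - f)%N \/ k = #|S| by rewrite /k; lia.
    have : (#|T| <= \sum_(j in T) dem j)%N.
      by rewrite -sum1_card leq_sum // => j /(fintype.subsetP TS)/demS/andP[].
    by rewrite /f in fd kE *; lia.
  have -> : T = S by apply/eqP; rewrite eqEcard TS cT kE /=.
  by rewrite finset.setDv big_set0 addn0; lia.
have TW : \sum_(j in T) w j <= \sum_(j in S) w j.
  rewrite [leRHS](big_setID T) /= (finset.setIidPr TS) lerDl sumr_ge0 // => j.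
  by rewrite inE => /andP[_ /w0].
have W0 : 0 <= \sum_(j in S) w j by exact: sumr_ge0.
have Dm : (\sum_(j in S) dem j <= #|S| * m)%N.
  by rewrite -sum_nat_const leq_sum // => j /demS/andP[].
have -> : C%:R = f%:R + (\sum_(j in S) dem j)%:R :> R.
  by rewrite -natrD /f; congr _%:R; lia.
have {}Dm : (\sum_(j in S) dem j)%:R <= #|S|%:R * m%:R :> R.
  by rewrite -natrM ler_nat.
have kd : k%:R + f%:R <= (dem i)%:R :> R.
  by rewrite -natrD ler_nat; rewrite /k; lia.
have m1 : 1 <= m%:R :> R by rewrite ler1n; lia.
move: (\sum_(j in S) dem j)%:R (ler0n R (\sum_(j in S) dem j)) Dm => D D0 Dm.
move: f%:R (ler0n R f) kd => F F0 kd.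
move: leT ST TW W0; set wT := \sum_(j in T) w j; set W := \sum_(j in S) w j.
move: #|S|%:R m%:R k%:R (dem i)%:R m1 kd Dm => s M K d m1 kd Dm leT ST TW W0.
(* With [F] free and [D] used instances, [(F + D) * w i <= F * W + M * K * W <= M * W * (K + F) <= M
   * W * d]. *)
have h1 : (F + D) * w i <= (F + D) * wT by rewrite ler_wpM2l // addr_ge0.
have h2 : D * wT <= s * M * wT by rewrite ler_wpM2r //; lra.
have h3 : M * (s * wT) <= M * (K * W) by rewrite ler_wpM2l //; lra.
have h4 : F * wT <= F * W by rewrite ler_wpM2l.
have h5 : 1 * (F * W) <= M * (F * W) by rewrite ler_wpM2r // mulr_ge0.
have h6 : (M * W) * (K + F) <= (M * W) * d.
  by rewrite ler_wpM2l // mulr_ge0 //; lra.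
by lra.
Qed.
End Combinatorics.

Lemma gt0_powRD (R : realType) (a r s : R) :
  0 < a -> a `^ (r + s) = a `^ r * a `^ s.
Proof. by move=> a0; rewrite powRD // (gt_eqF a0) implybT. Qed.

Lemma gt1_powR (R : realType) (a r : R) : 1 < a -> 0 < r -> 1 < a `^ r.
Proof.
move=> a1 r0; have := gt0_ltr_powR r0 _ _ a1; rewrite powR1; apply.
  by rewrite nnegrE.
by rewrite nnegrE ltW // (lt_trans ltr01).
Qed.

(** Cut the time before [T] into unit windows. The starts in one window have total demand at most
    [C], and each window further back gains a factor [x^-1], so a geometric series bounds the
    sum. *)
Lemma discounted_load (R : realType) (I : finType) (P : pred I) (s : I -> R)
    (n : I -> nat) (x : R) (C : nat) :
  1 < x -> (forall i, P i -> 0 <= s i) ->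
  (forall t : R, 0 <= t ->
     (\sum_(i | P i && (s i <= t < s i + 1)%R) n i <= C)%N) ->
  forall T : R, \sum_(i | P i && (s i < T)) (n i)%:R * x `^ (s i - T)
            <= C%:R / (1 - x^-1).
Proof.
move=> x1 s0 load.
have x0 : 0 < x by lra.
have xV1 : x^-1 < 1 by rewrite invf_lt1.
have B0 : 0 <= C%:R / (1 - x^-1) by rewrite divr_ge0 // subr_ge0 ltW.
suff H N (T : R) : T <= N%:R -> \sum_(i | P i && (s i < T)) (n i)%:R * x `^ (s i - T)
            <= C%:R / (1 - x^-1).
  move=> T; apply: (H (Num.bound `|T|)); apply: ltW.
  exact: le_lt_trans (ler_norm _) (archi_boundP (normr_ge0 _)).
elim: N T => [|N IH] T TN.
  rewrite big_pred0 // => i; apply/negbTE/negP => /andP[/s0 ? ?]; lra.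
have {}IH := IH (T - 1); rewrite (bigID (fun i => s i < T - 1)) /=.
(* The bound is the fixed point of [B = x^-1 * B + C]: the first summand takes the starts before
   [T - 1], the second the last window. *)
have -> : C%:R / (1 - x^-1) = x^-1 * (C%:R / (1 - x^-1)) + C%:R.
  by field; apply/andP; split; lra.
apply: lerD.
  rewrite (eq_bigl (fun i => P i && (s i < T - 1))); last first.
    move=> i; rewrite -andbA; congr andb; apply/andP/idP => [[]//|h]; split=> //; lra.
  rewrite (eq_bigr (fun i => x^-1 * ((n i)%:R * x `^ (s i - (T - 1))))).
    rewrite -mulr_sumr ler_wpM2l //; first by rewrite invr_ge0 ltW.
    by apply: IH; rewrite -natr1 in TN; lra.
  move=> i _; rewrite (_ : s i - T = -1 + (s i - (T - 1))); last by lra.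
  rewrite (@gt0_powRD _ x (-1)) //.
  by rewrite powR_inv1 1?ltW // mulrCA.
have [none|] := boolP [forall i, ~~ (P i && (s i < T) && ~~ (s i < T - 1))].
  rewrite big_pred0 => [|i]; first by [].
  exact/negbTE/(forallP none).
rewrite negb_forall => /existsP[i0]; rewrite negbK => Pi0.
(* Every start in the last window lies less than one unit before the latest one, [s j], so all of
   them count towards the load at time [s j]. *)
pose late i := P i && (s i < T) && ~~ (s i < T - 1).
case: (@Order.TotalTheory.arg_maxP _ R I i0 late s Pi0) => j /andP[/andP[Pj jT] _] jmax.
apply: (@le_trans _ _ (\sum_(i | P i && (s i <= s j < s i + 1)) (n i)%:R)).
  rewrite big_mkcond [leRHS]big_mkcond /=; apply: ler_sum => i _.
  case: ifP => [hi|_]; last by case: ifP.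
  have ij : s i <= s j := jmax i hi.
  move: hi => /andP[/andP[-> iT]]; rewrite -leNgt => Ti.
  rewrite ij (_ : s j < s i + 1) /=; last by lra.
  rewrite ler_piMr // -[leRHS](powRr0 x) ler_powR //; lra.
by rewrite -natr_sum ler_nat load // s0.
Qed.
(** * Runs of Gamma_D *)

Section Mechanism.
Variables (R : realType) (chi : R) (rule : selection_rule R).
Variables (C : nat) (theta : seq (job R)).
Hypothesis chi_gt1 : 1 < chi.
Hypothesis rule_opt : knapsack_optimal rule.
Hypothesis release_ge0 : forall i : 'I_(size theta), 0 <= release (job_at i).
Hypothesis demand_gt0 : forall i : 'I_(size theta), (0 < demand (job_at i))%N.
Hypothesis len_gt0 : forall i : 'I_(size theta), 0 < len (job_at i).
Hypothesis value_gt0 : forall i : 'I_(size theta), 0 < value (job_at i).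
Local Notation I := 'I_(size theta).
Implicit Types (st : state theta) (i j : I) (A : {set I}).

(** The boosted value [v_i'] seen by the knapsack solver. *)
Definition weight st t i := value (job_at i) * chi `^ progress st t i.

Lemma weight_gt0 st t i : 0 < weight st t i.
Proof. by rewrite mulr_gt0 // powR_gt0 // (lt_trans ltr01). Qed.

Lemma critical_candidatesP st u :
  reflect ((exists i, u = release (job_at i)) \/
           (exists i s, start st i = Some s /\ u = s + len (job_at i)))
          (u \in critical_candidates st).
Proof.
rewrite mem_cat; apply: (iffP orP) => -[].
- by case/mapP => i _ ->; left; exists i.
- rewrite mem_pmap => /mapP[i _]; case Es: (start st i) => [s|] //= [->].
  by right; exists i, s.
- by case=> i ->; left; apply: map_f; rewrite mem_enum.
- case=> i [s [Es ->]]; right; rewrite mem_pmap; apply/mapP; exists i.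
    by rewrite mem_enum.
  by rewrite Es.
Qed.

Lemma next_criticalP st :
  if next_critical st is Some t then
    [/\ t \in critical_candidates st, clock st < t &
        forall u, u \in critical_candidates st -> clock st < u -> t <= u]
  else forall u, u \in critical_candidates st -> u <= clock st.
Proof.
rewrite /next_critical; set s := [seq _ <- _ | _].
have memE u : (u \in sort <=%R s) = (clock st < u) && (u \in critical_candidates st).
  by rewrite mem_sort mem_filter.
have := sort_sorted (@le_total _ R) s; move: memE.
case: (sort _ _) => [|t s'] memE /=.
  by move=> _ u uC; rewrite leNgt; apply/negP => lt_u; move: (memE u); rewrite lt_u uC.
move=> /(order_path_min le_trans)/allP t_min.
have := memE t; rewrite mem_head => /esym/andP[lt_t tC]; split=> // u uC lt_u.
by have := memE u; rewrite lt_u uC inE => /orP[/eqP->//|/t_min].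
Qed.

Lemma next_critical_gt st t : next_critical st = Some t -> clock st < t.
Proof. by move=> E; have := next_criticalP st; rewrite E => -[]. Qed.

Lemma next_critical_le st t u : next_critical st = Some t ->
  u \in critical_candidates st -> clock st < u -> t <= u.
Proof. by move=> E; have := next_criticalP st; rewrite E => -[_ _]; apply. Qed.

Lemma in_force_clock st : in_force st (clock st).
Proof.
rewrite /in_force lexx /=; case E: (next_critical st) => [t|] //.
exact: next_critical_gt.
Qed.

Lemma sum_selected (V : nmodType) (F : I -> V) st t :
  \sum_(i in selected chi rule C st t) F i =
  \sum_(i <- mask (rule C t [seq item_of chi st t i | i <- enum (feasible_jobs st t)])
               (enum (feasible_jobs st t))) F i.
Proof.
rewrite big_uniq /=; last by rewrite mask_uniq // enum_uniq.
by apply: eq_bigl => i; rewrite inE.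
Qed.

Lemma selected_feasible st t :
  selected chi rule C st t \subset feasible_jobs st t.
Proof. by apply/fintype.subsetP => i; rewrite inE => /mem_mask; rewrite mem_enum. Qed.

Lemma selected_fits st t :
  (\sum_(i in selected chi rule C st t) demand (job_at i) <= C)%N.
Proof.
rewrite (sum_selected (fun i => demand (job_at i))).
have [fits _] := rule_opt C t [seq item_of chi st t i | i <- enum (feasible_jobs st t)].
by move: fits; rewrite -map_mask big_map.
Qed.

Lemma selected_max st t A : A \subset feasible_jobs st t ->
  (\sum_(i in A) demand (job_at i) <= C)%N ->
  \sum_(i in A) weight st t i <= \sum_(i in selected chi rule C st t) weight st t i.
Proof.
move=> /fintype.subsetP AF fitA; rewrite sum_selected.
set JF := enum _.
have sumA (V : nmodType) (F : I -> V) :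
    \sum_(i <- mask [seq i \in A | i <- JF] JF) F i = \sum_(i in A) F i.
  rewrite -filter_mask big_uniq /=; last by rewrite filter_uniq // enum_uniq.
  apply: eq_bigl => i; rewrite mem_filter mem_enum.
  by apply: andb_idr; apply: AF.
(* The competing set is offered to the rule as a bit mask over the enumerated feasible jobs. *)
have [_ /(_ [seq i \in A | i <- JF])] := rule_opt C t [seq item_of chi st t i | i <- JF].
by rewrite -!map_mask !big_map !sumA; apply.
Qed.

(** Invariant of the reachable states. The strict bound on the clock says that a run is removed at
    the very step at which it becomes complete, so no critical time jumps over a completion. *)
Definition sound st :=
  (forall i s, start st i = Some s ->
     [/\ release (job_at i) <= s <= clock st, clock st < s + len (job_at i),
         s + len (job_at i) <= deadline (job_at i) & i \notin finished st]) /\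
  (\sum_(i | start st i) demand (job_at i) <= C)%N.

Lemma sound_init : sound (init_state theta).
Proof. by split=> //; rewrite big_pred0. Qed.

Lemma progress_ge0 st t i : sound st -> clock st <= t -> 0 <= progress st t i.
Proof.
rewrite /progress => -[snd _] ct; case Es: (start st i) => [s|] //.
have [/andP[_ sc] _ _ _] := snd _ _ Es.
by rewrite divr_ge0 ?(ltW (len_gt0 i)) // subr_ge0 (le_trans sc).
Qed.

Lemma progress_ge1 st t i s : start st i = Some s ->
  (1 <= progress st t i) = (s + len (job_at i) <= t).
Proof.
by move=> Es; rewrite /progress Es ler_pdivlMr // mul1r lerBrDl.
Qed.

Lemma next_le_completion st t i s : sound st -> next_critical st = Some t ->
  start st i = Some s -> t <= s + len (job_at i).
Proof.
move=> [snd _] E Es; have [_ h _ _] := snd _ _ Es.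
by apply: (next_critical_le E) h; apply/critical_candidatesP; right; exists i, s.
Qed.

(** The remaining length of a running job shrinks exactly as fast as the time left until its
    deadline. *)
Lemma running_feasible st t i : sound st -> next_critical st = Some t ->
  start st i -> i \notin finished_at st t -> i \in feasible_jobs st t.
Proof.
move=> snd E; case Es: (start st i) => [s|] // _ nf; rewrite inE nf andbT.
have [/andP[rs sc] h dl _] := snd.1 _ _ Es; have ct := next_critical_gt E.
apply/andP; split; first by lra.
rewrite /progress Es mulrBl mul1r divfK ?gt_eqF //; lra.
Qed.

Lemma start_process st t i : start (process chi rule C st t) i =
  if i \in selected chi rule C st t then Some (odflt t (start st i)) else None.
Proof. by []. Qed.

Lemma weight_process st t i : i \in selected chi rule C st t ->
  weight (process chi rule C st t) t i = weight st t i.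
Proof.
rewrite /weight /progress start_process => ->.
by case: (start st i) => //=; rewrite subrr mul0r.
Qed.

Lemma sound_step st : sound st -> sound (step chi rule C st).
Proof.
move=> snd; rewrite /step; case E: (next_critical st) => [t|] //.
split=> [i s|]; last first.
  under eq_bigl => i do rewrite start_process.
  rewrite (eq_bigl [in selected chi rule C st t]) ?selected_fits // => i.
  by case: ifP.
rewrite start_process; case: ifP => // iS [<-].
have := fintype.subsetP (selected_feasible st t) _ iS.
rewrite inE /= => /and3P[rt fe nf].
have ct := next_critical_gt E.
case Es: (start st i) => [s'|] /=; last first.
  move: fe; rewrite /progress Es subr0 mul1r => fe; rewrite lexx rt /=.
  have := len_gt0 i; split=> //; lra.
have [/andP[rs sc] h dl _] := snd.1 _ _ Es; split=> //; first by rewrite rs; lra.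
move: nf; rewrite !inE negb_or => /andP[_].
by rewrite (progress_ge1 _ Es) -ltNge.
Qed.

Definition st_ k := iter k (@step R chi rule C theta) (init_state theta).

Lemma sound_st k : sound (st_ k).
Proof. by elim: k => [|k IH]; [exact: sound_init|exact: sound_step]. Qed.

Lemma st_next k t : next_critical (st_ k) = Some t ->
  st_ k.+1 = process chi rule C (st_ k) t.
Proof. by rewrite /st_ iterS {2}/step => ->. Qed.

Lemma st_stuck k m : next_critical (st_ k) = None -> (k <= m)%N -> st_ m = st_ k.
Proof.
move=> E /subnK <-; elim: (m - k)%N => [|d IH] //.
by rewrite addSn /st_ iterS -/(st_ _) IH /step E.
Qed.

(** A running job would supply its completion as a further critical time. *)
Lemma stuck_idle k i : next_critical (st_ k) = None -> start (st_ k) i = None.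
Proof.
move=> E; case Es: (start _ i) => [s|] //.
have [_ h _ _] := (sound_st k).1 _ _ Es.
have := next_criticalP (st_ k); rewrite E => /(_ (s + len (job_at i))).
rewrite leNgt h => H; suff: false by []; apply: H.
by apply/critical_candidatesP; right; exists i, s.
Qed.

Lemma clock_le k m : (k <= m)%N -> clock (st_ k) <= clock (st_ m).
Proof.
move: k m; apply: (homo_leq (f := fun k => clock (st_ k))
  (r := fun a b : R => a <= b)).
- by move=> a; apply: lexx.
- by move=> b a c; apply: le_trans.
move=> j.
rewrite /st_ iterS -/(st_ _) /step; case E: (next_critical _) => [t|] //=.
exact/ltW/next_critical_gt.
Qed.

Lemma finished_sub k m : (k <= m)%N -> finished (st_ k) \subset finished (st_ m).
Proof.
move: k m; apply: (homo_leq (f := fun k => finished (st_ k))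
  (r := fun A B : {set I} => A \subset B)).
- by move=> A; apply: subxx.
- by move=> B A D; apply: fintype.subset_trans.
move=> j; rewrite /st_ iterS -/(st_ _) /step; case E: (next_critical _) => [t|] //=.
exact: finset.subsetUl.
Qed.

(* Each critical time is the release of a pending job or the completion of an
   unfinished one. *)
Definition pending st : nat :=
  #|[set i : I | (clock st < release (job_at i))%R]| + #|~: finished st|.

Lemma pending_process st t : sound st -> next_critical st = Some t ->
  (pending (process chi rule C st t) < pending st)%N.
Proof.
move=> snd E; have ct := next_critical_gt E.
have := next_criticalP st; rewrite E => -[tC _ _].
have sub1 : [set i : I | t < release (job_at i)] \subset
              [set i : I | clock st < release (job_at i)].
  by apply/fintype.subsetP => i; rewrite !inE; apply: lt_trans.
have sub2 : ~: finished_at st t \subset ~: finished st.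
  by rewrite finset.setCS finset.subsetUl.
rewrite /pending /=; case/critical_candidatesP: tC => [[i ti]|[i [s [Es ti]]]].
  rewrite -addSn leq_add ?subset_leq_card // proper_card // properE sub1 /=.
  by apply/subsetPn; exists i; rewrite !inE -ti ?ltxx.
rewrite -addnS leq_add ?subset_leq_card // proper_card // properE sub2 /=.
apply/subsetPn; exists i; rewrite !inE ?(progress_ge1 _ Es) -?ti ?lexx ?orbT //.
by case: (snd.1 _ _ Es).
Qed.

Lemma eventually_stuck : exists N, next_critical (st_ N) = None.
Proof.
suff H m st : (pending st <= m)%N -> sound st ->
    exists N, next_critical (iter N (@step R chi rule C theta) st) = None.
  exact: H (leqnn _) sound_init.
elim: m st => [|m IH] st lem snd; case E: (next_critical st) => [t|];
  try by exists 0%N.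
  by have := pending_process snd E; lia.
have [||N EN] := IH (step chi rule C st); last by exists N.+1; rewrite iterSr.
  by have := pending_process snd E; rewrite /step E; lia.
exact: sound_step.
Qed.

(** * From the sequence of states to the allocation over time *)

Lemma in_force_next k t u : next_critical (st_ k) = Some t -> in_force (st_ k) u ->
  u < clock (st_ k.+1).
Proof. by move=> E; rewrite (st_next E) /in_force E => /andP[]. Qed.

(** The least step whose next critical time is after [u] or missing. By minimality no earlier step
    is stuck, so the state found is either initial or the outcome of a genuine [process]. *)
Lemma exists_in_force u : 0 <= u -> exists k, in_force (st_ k) u /\
  forall m, (m < k)%N -> next_critical (st_ m).
Proof.
move=> u0; have [N EN] := eventually_stuck.
pose P k := if next_critical (st_ k) is Some t then u < t else true.
have exP : exists k, P k by exists N; rewrite /P EN.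
case: (ex_minnP exP) => k Pk kmin; exists k; split; last first.
  move=> m mk; have : ~~ P m by apply/negP => /kmin; rewrite leqNgt mk.
  by rewrite /P; case: next_critical.
rewrite /in_force [X in _ && X]Pk andbT; case: k {Pk} kmin => [|k] kmin.
  by rewrite /= (le_trans _ u0) // oppr_le0.
have : ~~ P k by apply/negP => /kmin; rewrite ltnn.
by rewrite /P; case E: (next_critical _) => [t|] //; rewrite -leNgt (st_next E).
Qed.

(** Two different indices are in force at the same time only once the mechanism is stuck, and then
    the states coincide. *)
Lemma in_force_start k m u : in_force (st_ k) u -> in_force (st_ m) u ->
  start (st_ k) = start (st_ m).
Proof.
wlog: k m / (k <= m)%N => [H|km].
  by case: (leqP k m) => [/H//|/ltnW/H h] /h{}h /h.
case E: (next_critical (st_ k)) => [t|]; last by rewrite (st_stuck E km).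
move: km; rewrite leq_eqVlt => /orP[/eqP-> //|km] fk /andP[cm _].
by have := in_force_next E fk; rewrite ltNge (le_trans (clock_le km)).
Qed.

(** A recorded start survives only steps that select the job, so the run can be traced back step by
    step to [s]. *)
Lemma run_at_of_start k i s t : start (st_ k) i = Some s ->
  s <= t <= clock (st_ k) -> run_at chi rule C t i.
Proof.
elim: k => [//|k IH] in s *.
case E: (next_critical (st_ k)) => [u|]; last first.
  by rewrite (st_stuck E (leqnSn k)); apply: IH.
move=> Es /andP[st tc].
move: (tc); rewrite le_eqVlt => /orP[/eqP->|lt_t].
  by exists k.+1; rewrite /= -/(st_ k.+1) Es in_force_clock.
move: Es; rewrite (st_next E) start_process; case: ifP => // iS [].
case Es: (start (st_ k) i) => [s'|] /= [s's]; last first.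
  by move: lt_t; rewrite (st_next E) /= ltNge s's st.
rewrite -{}s's in st *; have [tk|kt] := leP t (clock (st_ k)).
  by apply: IH Es _; rewrite st.
exists k; rewrite /= -/(st_ k) Es andbT /in_force ltW //= E.
by move: lt_t; rewrite (st_next E).
Qed.

Lemma finished_completed k i : i \in finished (st_ k) ->
  completed_in (GammaD_allocation chi rule C (theta := theta)) i.
Proof.
elim: k => [|k IH]; first by rewrite inE.
case E: (next_critical (st_ k)) => [u|]; last by rewrite (st_stuck E (leqnSn k)).
rewrite (st_next E) !inE => /orP[//|].
case Es: (start (st_ k) i) => [s|]; last by rewrite /progress Es ler10.
rewrite (progress_ge1 _ Es) => su.
have [/andP[rs sc] h dl _] := (sound_st k).1 _ _ Es.
exists s; split=> // t /andP[st ts]; rewrite /GammaD_allocation.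
rewrite ifT //; apply/asboolP; have [tk|kt] := leP t (clock (st_ k)).
  by apply: run_at_of_start Es _; rewrite st.
exists k; rewrite /= -/(st_ k) Es andbT /in_force ltW //= E.
exact: lt_le_trans ts su.
Qed.

(** Suppose the job never enters [finished]. Its run, which may have begun before [s], then cannot
    end: an interruption would fall inside the interval of uninterrupted service. But a stuck state
    runs nothing. *)
Lemma completed_finished i :
  completed_in (GammaD_allocation chi rule C (theta := theta)) i ->
  exists k, i \in finished (st_ k).
Proof.
move=> [s [rs _ run]]; apply: contrapT => /forallNP unfinished.
have {}run k t : in_force (st_ k) t -> s <= t < s + len (job_at i) -> start (st_ k) i.
  move=> fk /run; rewrite /GammaD_allocation; case: asboolP => [[m]|_]; last first.
    by have := demand_gt0 i; case: (demand _).
  by move=> /andP[fm sm _]; rewrite (in_force_start fk fm).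
have s0 := le_trans (release_ge0 i) rs.
have [k0 [f0 _]] := exists_in_force s0.
have := run k0 s f0; rewrite lexx ltrDl len_gt0 => /(_ isT).
case E0: (start (st_ k0) i) => [s0'|] // _.
have s0's : s0' <= s.
  have [/andP[_ h] _ _ _] := (sound_st k0).1 _ _ E0.
  by apply: le_trans h _; case/andP: f0.
have [N EN] := eventually_stuck.
have H d : start (st_ (k0 + d)) i = Some s0'; last first.
  have := H N; rewrite (st_stuck EN) ?leq_addl //.
  by rewrite stuck_idle.
elim: d => [|d IH]; rewrite ?addn0 // addnS.
case E: (next_critical (st_ (k0 + d))) => [u|]; last first.
  by rewrite (st_stuck E (leqnSn _)).
have su : s < u.
  case E1: (next_critical (st_ k0)) => [u1|].
    rewrite (lt_le_trans (in_force_next E1 f0)) //.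
    rewrite (_ : u = clock (st_ (k0 + d).+1)) ?(st_next E) //.
    by rewrite -(st_next E) clock_le // ltnS leq_addr.
  by have := E; rewrite (st_stuck E1) ?leq_addr // E1.
have := unfinished (k0 + d).+1; rewrite (st_next E) !inE => /negP.
rewrite negb_or (progress_ge1 _ IH) -ltNge => /andP[_ us].
have := run (k0 + d).+1 u; rewrite (st_next E) start_process IH.
have -> : s <= u < s + len (job_at i) by apply/andP; split; lra.
rewrite (in_force_clock (process chi rule C (st_ (k0 + d)) u)).
by case: ifP => // _ /(_ isT isT).
Qed.
(** * The upper bound *)

Variables kappa nmax : nat.
Hypothesis kappa_gt0 : (0 < kappa)%N.
Hypothesis len_le : forall i : 'I_(size theta), len (job_at i) <= kappa%:R.
Hypothesis demand_le : forall i : 'I_(size theta), (demand (job_at i) <= nmax)%N.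
Hypothesis nmax_le : (nmax <= C)%N.

Let x : R := chi `^ (kappa%:R^-1).

Let chi_gt0 : 0 < chi. Proof. exact: lt_trans chi_gt1. Qed.
Let kappaR_gt0 : 0 < kappa%:R :> R. Proof. by rewrite ltr0n. Qed.

Let x_gt1 : 1 < x.
Proof. by rewrite gt1_powR // invr_gt0. Qed.

Let x_gt0 : 0 < x. Proof. exact: lt_trans x_gt1. Qed.

Let powxE u : x `^ u = chi `^ (u / kappa%:R).
Proof. by rewrite mulrC powRrM. Qed.

Let powxD u v : x `^ (u + v) = x `^ u * x `^ v.
Proof. exact: gt0_powRD. Qed.

(** * Growth of the total boosted value *)

Definition running_weight st := \sum_(i | start st i) weight st (clock st) i.

Lemma running_weight_process st t : running_weight (process chi rule C st t) =
  \sum_(i in selected chi rule C st t) weight st t i.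
Proof.
rewrite /running_weight; apply: eq_big => [i|i].
  by rewrite start_process; case: ifP.
by rewrite start_process; case: ifP => // iS _; rewrite weight_process.
Qed.

(** Every part of the selection that leaves room for [i] competes, together with [i], against the
    whole selection; this is the optimality that [exchange_bound] asks for. *)
Lemma unselected_bound st t i :
  i \in feasible_jobs st t -> i \notin selected chi rule C st t ->
  C%:R * weight st t i <=
    (demand (job_at i))%:R * nmax%:R * running_weight (process chi rule C st t).
Proof.
move=> iF iS; rewrite running_weight_process.
apply: (exchange_bound (w := weight st t) (dem := fun j => demand (job_at j))) => //.
- by rewrite demand_gt0 demand_le.
- by move=> j _; rewrite demand_gt0 demand_le.
- exact: selected_fits.
- exact: weight_gt0.
- by move=> j _; apply/ltW/weight_gt0.
move=> T TS fit.
have iT : i \notin T by apply: contra iS; apply/fintype.subsetP.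
have := @selected_max st t (i |: T); rewrite !big_setU1 //; apply=> //.
apply/fintype.subsetP => j; rewrite in_setU1 => /orP[/eqP-> //|].
by move=> /(fintype.subsetP TS)/(fintype.subsetP (selected_feasible st t)).
Qed.

(** The progress of a running job grows at rate [1 / len], which is at least [1 / kappa], and [x] is
    the [kappa]-th root of [chi]. *)
Lemma weight_growth st t u i : start st i -> t <= u ->
  weight st t i * x `^ (u - t) <= weight st u i.
Proof.
case Es: (start st i) => [s|] // _ tu; rewrite /weight -mulrA ler_pM2l // powxE.
rewrite -gt0_powRD //; apply: ler_powR; first exact: ltW.
rewrite /progress Es (_ : u - s = (t - s) + (u - t)); last by ring.
rewrite [leRHS]mulrDl lerD2l.
by rewrite ler_wpM2l ?subr_ge0 // lef_pV2 ?posrE.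
Qed.

(** The running jobs that do not complete at [t] remain an admissible choice, so the new selection
    weighs at least as much; the others complete with boost exactly [chi]. *)
Lemma running_weight_step st t : sound st -> next_critical st = Some t ->
  running_weight st * x `^ (t - clock st) <=
    running_weight (process chi rule C st t) +
    \sum_(i in finished_at st t :\: finished st) chi * value (job_at i).
Proof.
move=> snd E; have ct := ltW (next_critical_gt E).
apply: (@le_trans _ _ (\sum_(i | start st i) weight st t i)).
  by rewrite mulr_suml; apply: ler_sum => i ri; exact: weight_growth.
rewrite (bigID [in finished_at st t]) /= addrC running_weight_process lerD //.
  pose A := [set i | start st i & i \notin finished_at st t].
  rewrite (eq_bigl [in A]) => [|i]; last by rewrite [RHS]finset.in_set.
  apply: selected_max.
    apply/fintype.subsetP => i; rewrite /A finset.in_set => /andP[ri].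
    exact: running_feasible.
  apply: leq_trans snd.2; rewrite [leqRHS](bigID [in finished_at st t]) /= addnC.
  rewrite (eq_bigl (fun i => start st i && (i \notin finished_at st t))) ?leq_addr //.
  by move=> i; rewrite [LHS]finset.in_set.
rewrite [leLHS]big_mkcond [leRHS]big_mkcond /=; apply: ler_sum => i _.
case Es: (start st i) => [s|] /=; last first.
  by case: ifP => // _; rewrite mulr_ge0 // ltW.
have [_ _ _ nf] := snd.1 _ _ Es.
rewrite !inE (negbTE nf) /= (progress_ge1 _ Es); case: ifP => // st'.
(* The next critical time is never later than a completion, so progress cannot exceed 1. *)
suff p1 : progress st t i = 1 by rewrite /weight p1 powRr1 ?(ltW chi_gt0) // mulrC.
apply/eqP; rewrite eq_le (progress_ge1 _ Es) st' andbT.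
rewrite /progress Es ler_pdivrMr // mul1r lerBlDl.
exact: next_le_completion E Es.
Qed.

(** * Charging missed jobs to later completions *)

Variable N : nat.
Hypothesis stuckN : next_critical (st_ N) = None.

Definition gain h :=
  \sum_(j in finished (st_ h.+1) :\: finished (st_ h)) chi * value (job_at j).

(* The value completed after step k, boosted to full progress and discounted to
   time 0. *)
Definition future_value k :=
  \sum_(k <= h < N) x `^ (- clock (st_ h.+1)) * gain h.

Let gain_ge0 h : 0 <= gain h.
Proof. by apply: sumr_ge0 => j _; rewrite mulr_ge0 // ltW. Qed.

Lemma future_value_anti k : future_value k.+1 <= future_value k.
Proof.
have [kN|Nk] := ltnP k N; last by rewrite /future_value !big_geq // leqW.
by rewrite [leRHS]/future_value big_ltn // lerDr mulr_ge0 // powR_ge0.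
Qed.

Lemma future_value_ge0 k : 0 <= future_value k.
Proof. by apply: sumr_ge0 => h _; rewrite mulr_ge0 // powR_ge0. Qed.

Lemma stuck_ge k : (N <= k)%N -> next_critical (st_ k) = None.
Proof. by move=> Nk; rewrite (st_stuck stuckN). Qed.

(** Backward induction from the stuck step, where nothing runs, for claims about the remaining
    run. *)
Lemma down_ind (P : nat -> Prop) :
  (forall k, next_critical (st_ k) = None -> P k) ->
  (forall k t, (k < N)%N -> next_critical (st_ k) = Some t -> P k.+1 -> P k) ->
  forall k, P k.
Proof.
move=> P0 PS k; have [Nk|kN] := leqP N k; first exact/P0/stuck_ge.
rewrite -(subKn (ltnW kN)); move: (leq_subr k N); elim: (N - k)%N => [|d IH] dN.
  by rewrite subn0; apply: P0.
case E: (next_critical (st_ (N - d.+1))) => [t|]; last exact: P0.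
apply: PS E _; first by lia.
by rewrite (_ : (N - d.+1).+1 = N - d)%N; [apply: IH; lia|lia].
Qed.

Lemma running_weight_le k :
  running_weight (st_ k) <= x `^ (clock (st_ k)) * future_value k.
Proof.
elim/down_ind: k => [k E|k t kN E IH].
  rewrite /running_weight big_pred0 => [|i]; last by rewrite stuck_idle.
  by rewrite mulr_ge0 ?powR_ge0 ?future_value_ge0.
have := running_weight_step (sound_st k) E; rewrite -(st_next E).
have Et : clock (st_ k.+1) = t by rewrite (st_next E).
have Ef : finished_at (st_ k) t = finished (st_ k.+1) by rewrite (st_next E).
rewrite Ef => le1; rewrite /future_value big_ltn // -/(future_value k.+1) Et.
rewrite Et in IH.
have xt : 0 < x `^ (t - clock (st_ k)) by rewrite powR_gt0.
rewrite -(ler_pM2r xt); apply: (le_trans le1).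
rewrite mulrAC -powxD [clock _ + _]addrC subrK mulrDr mulrA -powxD subrr powRr0.
by rewrite mul1r [leRHS]addrC lerD2r.
Qed.

(** Follow the run to the time [t] at which [i] is dropped. Since [s] its weight has grown by at
    least [x ^ (t - s)], which pays for dating the charge at [s] instead of [t]. *)
Lemma interrupted_bound i k s :
  i \notin finished (st_ N) -> start (st_ k) i = Some s ->
  C%:R * value (job_at i) <=
    (demand (job_at i))%:R * nmax%:R * (x `^ s * future_value k).
Proof.
move=> nF; elim/down_ind: k s => [k E s|k t kN E IH s Es].
  by rewrite stuck_idle.
have nf : i \notin finished (st_ k.+1).
  by apply: contra nF; apply/fintype.subsetP/finished_sub.
have mono : (demand (job_at i))%:R * nmax%:R * (x `^ s * future_value k.+1) <=
    (demand (job_at i))%:R * nmax%:R * (x `^ s * future_value k).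
  by rewrite ler_wpM2l ?mulr_ge0 // ler_wpM2l ?powR_ge0 ?future_value_anti.
apply: le_trans mono.
have [iS|iS] := boolP (i \in selected chi rule C (st_ k) t).
  by apply: IH; rewrite (st_next E) start_process iS Es.
rewrite (st_next E) in nf.
have ct := next_critical_gt E.
have iF := running_feasible (sound_st k) E (_ : start (st_ k) i) nf.
have := unselected_bound (iF _) iS; rewrite Es => /(_ isT).
rewrite -(st_next E) => le1.
have [/andP[_ sc] _ _ _] := (sound_st k).1 _ _ Es.
have le2 : value (job_at i) * x `^ (t - s) <= weight (st_ k) t i.
  have := @weight_growth (st_ k) s t i.
  rewrite Es /weight {1}/progress Es subrr mul0r powRr0 mulr1; apply=> //; lra.
have le3 := running_weight_le k.+1.
rewrite (st_next E) [clock _]/= -(st_next E) in le3.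
rewrite -(ler_pM2r (powR_gt0 (t - s) x_gt0)) -[leLHS]mulrA -[leRHS]mulrA.
apply: (le_trans (ler_wpM2l (ler0n _ _) le2)); apply: (le_trans le1).
rewrite ler_wpM2l ?mulr_ge0 //; apply: (le_trans le3).
by rewrite mulrAC -powxD addrC subrK.
Qed.

(* A missed job is either not running at the time s at which it could have been
   started, or already running and interrupted later on. *)
Lemma missed_bound i s :
  i \notin finished (st_ N) -> release (job_at i) <= s ->
  s + len (job_at i) <= deadline (job_at i) ->
  exists2 k, in_force (st_ k) s & C%:R * value (job_at i) <=
    (demand (job_at i))%:R * nmax%:R * (x `^ s * future_value k).
Proof.
move=> nF rs sd; have s0 : 0 <= s := le_trans (release_ge0 i) rs.
have [k [fk active]] := exists_in_force s0; exists k => //; case/andP: (fk) => cs fks.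
have mono u : u <= s ->
    (demand (job_at i))%:R * nmax%:R * (x `^ u * future_value k) <=
    (demand (job_at i))%:R * nmax%:R * (x `^ s * future_value k).
  move=> us; rewrite ler_wpM2l ?mulr_ge0 // ler_wpM2r ?future_value_ge0 //.
  by apply: ler_powR => //; apply: ltW.
case Es: (start (st_ k) i) => [s'|].
  apply: (le_trans (interrupted_bound nF Es)); apply: mono.
  by have [/andP[_ h] _ _ _] := (sound_st k).1 _ _ Es; apply: le_trans h cs.
(* A release after the clock and up to [s] would be a critical time, but [st_ k] is still in force
   at [s]. *)
have rk : release (job_at i) <= clock (st_ k).
  rewrite leNgt; apply/negP => kr.
  have rC : release (job_at i) \in critical_candidates (st_ k).
    by apply/critical_candidatesP; left; exists i.
  case E: (next_critical (st_ k)) fks => [u|] fks.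
    by have := next_critical_le E rC kr; rewrite leNgt (le_lt_trans rs fks).
  by have := next_criticalP (st_ k); rewrite E => /(_ _ rC); rewrite leNgt kr.
(* The initial clock -1 precedes every release, so at least one critical time has been processed. *)
case: k => [|k] in fk active cs fks mono Es rk *.
  by have := le_trans (release_ge0 i) rk; rewrite /= oppr_ge0 ler10.
case E: (next_critical (st_ k)) => [t|]; last first.
  by have := active k (leqnn _); rewrite E.
rewrite (st_next E) in cs Es rk; rewrite /= in cs rk.
have iS : i \notin selected chi rule C (st_ k) t.
  by move: Es; rewrite start_process; case: ifP.
(* A start at [s] meets the deadline, and [t <= s]. *)
have iF : i \in feasible_jobs (st_ k) t.
  rewrite inE rk /=; apply/andP; split; last first.
    rewrite -(_ : finished (st_ k.+1) = finished_at (st_ k) t) ?(st_next E) //.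
    apply: contra nF; rewrite -(st_next E); have [kN|Nk] := leqP k.+1 N.
      exact/fintype.subsetP/finished_sub.
    by rewrite (st_stuck stuckN) // ltnW.
  have ct := ltW (next_critical_gt E).
  have p0 := progress_ge0 i (sound_st k) ct.
  have := mulr_ge0 p0 (ltW (len_gt0 i)); lra.
have := unselected_bound iF iS; rewrite -(st_next E) => le1.
have le2 : value (job_at i) <= weight (st_ k) t i.
  apply: ler_peMr; first exact: ltW.
  rewrite -[leLHS](powRr0 chi); apply: ler_powR; first exact: ltW.
  exact: progress_ge0 (sound_st k) (ltW (next_critical_gt E)).
apply: le_trans (mono _ cs).
apply: (le_trans (ler_wpM2l (ler0n _ _) le2)); apply: (le_trans le1).
rewrite ler_wpM2l ?mulr_ge0 //.
by have := running_weight_le k.+1; rewrite {2}(st_next E).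
Qed.

(** Replaces the index [k] by a condition on times, so that the charges of all missed jobs can be
    summed in the other order. If [k] is stuck, all gains from [k] on vanish. *)
Lemma future_value_le k s : in_force (st_ k) s ->
  future_value k <= \sum_(h < N | s < clock (st_ h.+1))
    x `^ (- clock (st_ h.+1)) * gain h.
Proof.
move=> fk; rewrite /future_value -(big_mkord (fun h => s < clock (st_ h.+1))
  (fun h => x `^ (- clock (st_ h.+1)) * gain h)).
have [Nk|kN] := leqP N k.
  rewrite [leLHS]big_geq //; apply: sumr_ge0 => h _; rewrite mulr_ge0 // powR_ge0 //.
rewrite [leRHS](big_cat_nat (n := k)) //=; last exact: ltnW.
rewrite -[leLHS]add0r; apply: lerD.
  by apply: sumr_ge0 => h _; rewrite mulr_ge0 // powR_ge0.
rewrite [leRHS]big_mkcond; apply: ler_sum_nat => h /andP[kh _].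
case: ltP => // hs.
case E: (next_critical (st_ k)) => [t|].
  by have := in_force_next E fk; rewrite ltNge (le_trans (clock_le (kh : k < h.+1)%N) hs).
by rewrite /gain (st_stuck E (leqW kh)) (st_stuck E kh) finset.setDv big_set0 mulr0.
Qed.

Lemma sum_gain m :
  \sum_(h < m) gain h = chi * \sum_(j in finished (st_ m)) value (job_at j).
Proof.
rewrite mulr_sumr; elim: m => [|m IH]; first by rewrite big_ord0 big_set0.
rewrite big_ord_recr /= {}IH [RHS](big_setID (finished (st_ m))) /=.
by rewrite (finset.setIidPr (finished_sub (leqnSn m))).
Qed.

Hypothesis nmax_gt0 : (0 < nmax)%N.
Hypothesis len_ge1 : forall i : 'I_(size theta), 1 <= len (job_at i).

(** After exchanging the sums, the factor of [gain h] is the discounted demand of the offline starts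
    before that completion time, which [discounted_load] bounds. *)
Lemma missed_welfare (a : allocation theta) : feasible_allocation C a ->
  \sum_(i | `[< completed_in a i >] && (i \notin finished (st_ N))) value (job_at i)
  <= nmax%:R * (chi / (1 - x^-1)) * \sum_(j in finished (st_ N)) value (job_at j).
Proof.
move=> feas; pose P i := `[< completed_in a i >] && (i \notin finished (st_ N)).
rewrite -[leLHS]/(\sum_(i | P i) value (job_at i)).
(* An offline start for each completed job, with the dummy 0 for the others. *)
have exs i : exists s : R, completed_in a i ->
   [/\ release (job_at i) <= s, s + len (job_at i) <= deadline (job_at i) &
       forall t, s <= t < s + len (job_at i) -> (demand (job_at i) <= a t i)%N].
  by have [[s sP]|nc] := pselect (completed_in a i); [exists s|exists 0].
have [s sP] := boolp.choice exs.
have {}sP i : P i -> _ := fun Pi => sP i (asboolW (proj1 (andP Pi))).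
have C0 : 0 < C%:R :> R.
  by rewrite ltr0n (leq_trans nmax_gt0).
(* Lengths are at least 1, so every job started within the last unit of time still holds its
   instances at [t]. *)
have load t : 0 <= t ->
    (\sum_(i | P i && (s i <= t < s i + 1)%R) demand (job_at i) <= C)%N.
  move=> t0; apply: leq_trans (feas t t0).
  rewrite big_mkcond; apply: leq_sum => i _; case: ifP => // /andP[Pi /andP[st ts]].
  have [_ _] := sP _ Pi; apply; rewrite st (lt_le_trans ts) // lerD2l len_ge1 //.
have s0 i : P i -> 0 <= s i.
  by move=> Pi; have [rs _ _] := sP _ Pi; apply: le_trans rs; apply: release_ge0.
have le1 i : P i -> C%:R * value (job_at i) <=
    \sum_(h < N | s i < clock (st_ h.+1)) nmax%:R * gain h *
      ((demand (job_at i))%:R * x `^ (s i - clock (st_ h.+1))).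
  move=> Pi; have [rs sd _] := sP _ Pi.
  have [k fk] := missed_bound (proj2 (andP Pi)) rs sd; move/le_trans; apply.
  apply: le_trans (ler_wpM2l _ (ler_wpM2l _ (future_value_le fk))) _.
  - by rewrite mulr_ge0.
  - exact: powR_ge0.
  rewrite !mulr_sumr; apply: ler_sum => h _; rewrite powxD le_eqVlt.
  by apply/orP; left; apply/eqP; ring.
rewrite -(ler_pM2l C0) mulr_sumr; apply: (le_trans (ler_sum _ le1)).
rewrite (exchange_big_dep xpredT) //=.
apply: (@le_trans _ _ (\sum_(h < N) nmax%:R * gain h * (C%:R / (1 - x^-1)))).
  apply: ler_sum => h _; rewrite -mulr_sumr; apply: ler_wpM2l.
    by rewrite mulr_ge0 // gain_ge0.
  exact: discounted_load.
rewrite -mulr_suml -mulr_sumr sum_gain le_eqVlt.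
by apply/orP; left; apply/eqP; ring.
Qed.

Lemma OPT_le :
  OPT C theta <= (nmax%:R * (chi / (1 - x^-1)) + 1) *
    welfare (GammaD_allocation chi rule C (theta := theta)).
Proof.
have c0 : 0 <= nmax%:R * (chi / (1 - x^-1)).
  by rewrite mulr_ge0 // divr_ge0 ?(ltW chi_gt0) // subr_ge0 invf_le1 // ltW.
have FW : \sum_(j in finished (st_ N)) value (job_at j) <=
    welfare (GammaD_allocation chi rule C (theta := theta)).
  rewrite /welfare big_mkcond [leRHS]big_mkcond; apply: ler_sum => j _.
  case: ifP => [jF|_]; last by case: ifP => // _; rewrite ltW.
  by rewrite ifT //; apply/asboolP; apply: finished_completed jF.
apply: ge_sup.
  (* The empty allocation shows that the set of welfares has an element. *)
  exists (welfare (theta := theta) (fun _ _ => 0%N)), (fun _ _ => 0%N) => //.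
  by move=> t _; rewrite big1.
move=> _ [a feas ->]; rewrite {1}/welfare (bigID [in finished (st_ N)]) /=.
rewrite mulrDl mul1r addrC; apply: lerD.
  exact: le_trans (missed_welfare feas) (ler_wpM2l c0 FW).
apply: le_trans FW; rewrite big_mkcond [leRHS]big_mkcond; apply: ler_sum => j _.
case: ifP => [/andP[_ ->]//|_]; by case: ifP => // _; rewrite ltW.
Qed.
End Mechanism.

(** * The lower bound *)

Section Chain.
Variables (R : realType) (chi : R) (rule : selection_rule R) (C : nat).
Hypothesis chi_gt1 : 1 < chi.
Hypothesis rule_opt : knapsack_optimal rule.
(** Leaders fill the whole capacity, and each preempts the previous one; the other jobs are always
    outweighed by the running leader. Every job except the last leader [L] has no slack, hence is
    lost once it is idle after its release. So only [L] can be completed. *)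
Variables (J : nat -> job R) (N L : nat) (leader : pred nat).
Let theta := mkseq J N.
Local Notation I := 'I_(size theta).
Local Notation rel p := (release (J p)).

Lemma job_at_mkseq (i : I) : job_at i = J i.
Proof.
have iN : (i < N)%N by rewrite -[ltnRHS](size_mkseq J) ltn_ord.
by rewrite /job_at (tnth_nth (J 0)) nth_mkseq.
Qed.

Lemma lt_size_mkseq (i : I) : (i < N)%N.
Proof. by rewrite -[ltnRHS](size_mkseq J) ltn_ord. Qed.

Lemma exists_index p : (p < N)%N -> exists i : I, i = p :> nat.
Proof. by rewrite -[ltnRHS](size_mkseq J) => pN; exists (Ordinal pN). Qed.

Hypothesis release_ge0 : forall p, 0 <= rel p.
Hypothesis release_inc : forall p q, (p < q)%N -> rel p < rel q.
Hypothesis len_gt0 : forall p, 0 < len (J p).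
Hypothesis value_gt0 : forall p, 0 < value (J p).
Hypothesis demand_bounds : forall p, (0 < demand (J p) <= C)%N.
Hypothesis leader_demand : forall p, leader p -> demand (J p) = C.
Hypothesis leader0 : leader 0.
Hypothesis leaderL : leader L.
Hypothesis leader_le : forall p, leader p -> (p <= L)%N.
Hypothesis L_lt : (L < N)%N.
Hypothesis tight : forall p : nat, p != L -> deadline (J p) = rel p + len (J p).
Hypothesis loose : rel L + len (J L) <= deadline (J L).
Hypothesis relay : forall c p, leader c -> (c < p < N)%N ->
  (forall q, (c < q < p)%N -> ~~ leader q) -> rel p < rel c + len (J c).
Hypothesis leader_wins : forall c p, leader c -> leader p -> (c < p)%N ->
  value (J c) * chi `^ ((rel p - rel c) / len (J c)) < value (J p).
Hypothesis other_loses : forall c p, leader c -> ~~ leader p -> (c < p)%N ->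
  value (J p) < value (J c) * chi `^ ((rel p - rel c) / len (J c)).

Implicit Type st : state theta.

Let release_le p q : (rel p <= rel q) = (p <= q)%N.
Proof.
case: (leqP p q) => [|/release_inc]; last by rewrite ltNge => /negbTE.
by rewrite leq_eqVlt => /orP[/eqP->|/release_inc/ltW//]; rewrite lexx.
Qed.

Let value_at_gt0 (i : I) : 0 < value (job_at i).
Proof. by rewrite job_at_mkseq. Qed.
Let len_at_gt0 (i : I) : 0 < len (job_at i).
Proof. by rewrite job_at_mkseq. Qed.
Let release_at_ge0 (i : I) : 0 <= release (job_at i).
Proof. by rewrite job_at_mkseq. Qed.
Let demand_at_gt0 (i : I) : (0 < demand (job_at i))%N.
Proof. by rewrite job_at_mkseq; case/andP: (demand_bounds i). Qed.

(** With at most one rival, which is strictly lighter and does not fit beside [i], the optimum is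
    unique; the outcome is then independent of tie-breaking. *)
Lemma selected_dominant st t (i : I) : i \in feasible_jobs st t ->
  (forall j k, j \in feasible_jobs st t -> k \in feasible_jobs st t ->
     j != i -> k != i -> j = k) ->
  (forall j, j \in feasible_jobs st t -> j != i ->
     weight chi st t j < weight chi st t i /\
     (C < demand (job_at i) + demand (job_at j))%N) ->
  selected chi rule C st t = [set i].
Proof.
move=> iF uniq dom; set S := selected _ _ _ _ _.
have SF := fintype.subsetP (selected_feasible chi rule C st t).
have w0 j : 0 < weight chi st t j by exact: weight_gt0.
have iS : i \in S.
  apply/negPn/negP => iS.
  have : \sum_(j in [set i]) weight chi st t j <= \sum_(j in S) weight chi st t j.
    apply: (selected_max _ rule_opt); first by rewrite finset.sub1set.
    by rewrite big_set1 job_at_mkseq; case/andP: (demand_bounds i).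
  rewrite big_set1; have [->|/set0Pn[j jS]] := eqVneq S finset.set0.
    by rewrite big_set0 leNgt w0.
  have ji : j != i by apply: contraNneq iS => <-.
  have -> : S = [set j].
    apply/setP => k; rewrite finset.in_set1; apply/idP/eqP => [kS|->//].
    have ki : k != i by apply: contraNneq iS => <-.
    by apply: uniq ki ji; apply: SF.
  by rewrite big_set1 leNgt; case: (dom j (SF _ jS) ji) => ->.
apply/setP => j; rewrite finset.in_set1; apply/idP/eqP => [jS|->//].
apply/eqP/negPn/negP => ji; have [_] := dom j (SF _ jS) ji.
have := selected_fits chi C rule_opt st t; rewrite -/S (big_setD1 i) //=.
rewrite (big_setD1 j) /=; last by rewrite finset.in_setD1 ji.
by lia.
Qed.

Definition before_release st p := [/\ clock st < rel p,
  forall i, start st i -> rel p < rel i + len (J i) &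
  forall q, (q < p)%N -> rel q <= clock st].

Lemma next_release st p : (p < N)%N -> before_release st p ->
  (forall i s, start st i = Some s -> s = rel i) ->
  next_critical st = Some (rel p).
Proof.
move=> pN [cp run old] sE; have [i0 i0p] := exists_index pN.
have pC : rel p \in critical_candidates st.
  by apply/critical_candidatesP; left; exists i0; rewrite job_at_mkseq i0p.
have := next_criticalP st; case: (next_critical st) => [t|]; last first.
  by move/(_ _ pC); rewrite leNgt cp.
case=> tC ct /(_ _ pC cp) tp; congr Some; apply/eqP; rewrite eq_le tp /=.
case/critical_candidatesP: tC => [[i tE]|[i [s [Es tE]]]].
  rewrite job_at_mkseq in tE; rewrite tE release_le leqNgt; apply/negP => /old.
  by rewrite leNgt -tE ct.
rewrite job_at_mkseq (sE _ _ Es) in tE.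
by have := run i; rewrite Es -tE => /(_ isT)/ltW.
Qed.

(** Apart from the initial state, a run has two phases: [leading] lasts through all releases, and
    [over] begins when [L] completes. *)
Definition leading st p c :=
  [/\ (c <= p < N)%N, leader c, forall q, (c < q <= p)%N -> ~~ leader q &
   [/\ clock st = rel p,
       forall i : I, start st i = if i == c :> nat then Some (rel c) else None &
       finished st = finset.set0]].

Definition over st :=
  [/\ forall i : I, start st i = None, forall p, (p < N)%N -> rel p <= clock st &
      finished st \subset [set i : I | i == L :> nat]].

Lemma idle_tight_infeasible st t (i : I) : start st i = None ->
  (i != L :> nat) -> rel i < t -> i \notin feasible_jobs st t.
Proof.
move=> Es iL it; apply/negP; rewrite inE => /and3P[_ h _]; move: h.
rewrite /progress Es subr0 mul1r job_at_mkseq tight // {Es} => h; lra.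
Qed.

Lemma idle_feasible st t (i : I) : start st i = None -> t = rel i ->
  i \notin finished_at st t -> i \in feasible_jobs st t.
Proof.
move=> Es -> nf; rewrite inE nf andbT /progress Es job_at_mkseq lexx /=.
rewrite subr0 mul1r {Es nf}; have [->|iL] := eqVneq (i : nat) L.
  by move: loose; lra.
by rewrite tight //; lra.
Qed.

Lemma first_step st : st = init_state theta -> leading (step chi rule C st) 0 0.
Proof.
move=> stE; have N0 : (0 < N)%N by apply: leq_ltn_trans L_lt.
have E : next_critical st = Some (rel 0).
  apply: next_release => //; rewrite stE //; split=> //=.
  by apply: lt_le_trans (release_ge0 0); rewrite ltrN10.
have [i0 i00] := exists_index N0.
have start0 i : start st i = None by rewrite stE.
have fin0 : finished_at st (rel 0) = finset.set0.
  by apply/setP => i; rewrite !inE /progress start0 stE !inE /= ler10.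
have F0 j : j \in feasible_jobs st (rel 0) -> j = i0.
  rewrite inE job_at_mkseq release_le leqn0 => /and3P[/eqP j0 _ _].
  by apply: val_inj; rewrite /= j0 i00.
have sel : selected chi rule C st (rel 0) = [set i0].
  apply: selected_dominant => [|j k /F0-> /F0->|j /F0->] //; last by rewrite eqxx.
  by apply: idle_feasible; rewrite ?i00 // fin0 inE.
rewrite /step E; split=> //; first by move=> q; lia.
split=> //= i; rewrite sel finset.in_set1 start0 /= -i00.
by rewrite (inj_eq val_inj).
Qed.

Lemma leading_step st p c : sound C st -> leading st p c -> (p.+1 < N)%N ->
  leading (step chi rule C st) p.+1 (if leader p.+1 then p.+1 else c).
Proof.
move=> snd [/andP[cp pN] lc nol [ck stE fin]] p1N.
have [i0 i0c] := exists_index (leq_ltn_trans cp pN).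
have [i1 i1p] := exists_index p1N.
have p1c : rel p.+1 < rel c + len (J c).
  by apply: (relay lc) => [|q /andP[cq qp]]; [lia|apply: nol; rewrite cq].
have E : next_critical st = Some (rel p.+1).
  apply: next_release => //.
    split=> [|i|q qp]; first by rewrite ck release_inc.
      by rewrite stE; case: eqP => // ->.
    by rewrite ck release_le.
  by move=> i s; rewrite stE; case: eqP => // -> [].
have fin1 : finished_at st (rel p.+1) = finset.set0.
  apply/setP => i; rewrite finset.in_set0 /finished_at fin finset.set0U finset.in_set.
  apply/negbTE; rewrite -ltNge; case Es: (start st i) => [s|]; last first.
    by rewrite /progress Es.
  rewrite ltNge (progress_ge1 len_at_gt0 _ Es) -ltNge job_at_mkseq.
  by move: Es; rewrite stE; case: eqP => // -> [<-].
have i01 : i1 != i0 by rewrite -(inj_eq val_inj) /= i0c i1p; lia.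
have start1 : start st i1 = None.
  by rewrite stE i1p; case: eqP => // pc; lia.
have start0 : start st i0 = Some (rel c) by rewrite stE i0c eqxx.
have i1F : i1 \in feasible_jobs st (rel p.+1).
  by apply: idle_feasible; rewrite ?i1p // fin1 inE.
have i0F : i0 \in feasible_jobs st (rel p.+1).
  by apply: (running_feasible len_at_gt0 snd E); rewrite ?start0 // fin1 inE.
(* Any earlier idle job has no slack and is lost. It cannot be [L], since no leader after [c] has
   been released so far. *)
have F01 j : j \in feasible_jobs st (rel p.+1) -> (j == i0) || (j == i1).
  rewrite -!(inj_eq val_inj) /= i0c i1p => jF.
  have jp : (j <= p.+1)%N by move: jF; rewrite inE job_at_mkseq release_le => /andP[].
  apply/norP => -[jc jp1]; move: jF; apply/negP; apply: idle_tight_infeasible.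
  - by rewrite stE (negbTE jc).
  - apply/eqP => jL; have := leader_le lc; rewrite -jL => cj.
    have := nol j; rewrite jL leaderL => /(_ _)/negP; apply=> //; lia.
  - apply: release_inc; lia.
have w0 : weight chi st (rel p.+1) i0 =
    value (J c) * chi `^ ((rel p.+1 - rel c) / len (J c)).
  by rewrite /weight /progress start0 job_at_mkseq i0c.
have w1 : weight chi st (rel p.+1) i1 = value (J p.+1).
  by rewrite /weight /progress start1 job_at_mkseq i1p powRr0 mulr1.
have full : (C < demand (job_at i0) + demand (job_at i1))%N.
  rewrite !job_at_mkseq i0c (leader_demand lc).
  by case/andP: (demand_bounds i1); lia.
rewrite /step E; case: ifPn => lp.
  have sel : selected chi rule C st (rel p.+1) = [set i1].
    apply: selected_dominant => // [j k|j] /F01/orP[/eqP->|/eqP->]; rewrite ?eqxx //.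
      by move=> /F01/orP[/eqP->|/eqP->]; rewrite ?eqxx.
    by move=> _; rewrite w0 w1 addnC leader_wins.
  split=> //; [by rewrite leqnn|by move=> q; lia|split=> //= i].
  rewrite sel finset.in_set1 -i1p (inj_eq val_inj); case: eqP => // ->.
  by rewrite start1 /= i1p.
have sel : selected chi rule C st (rel p.+1) = [set i0].
  apply: selected_dominant => // [j k|j] /F01/orP[/eqP->|/eqP->]; rewrite ?eqxx //.
    by move=> /F01/orP[/eqP->|/eqP->]; rewrite ?eqxx.
  by move=> _; rewrite w0 w1 other_loses.
split=> //; first by rewrite leqW.
  move=> q /andP[cq]; rewrite leq_eqVlt => /orP[/eqP-> //|qp].
  by apply: nol; rewrite cq.
split=> //= i; rewrite sel finset.in_set1 -i0c (inj_eq val_inj).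
by case: eqP => // ->; rewrite start0 /= i0c.
Qed.

(** After all releases the running leader is [L], and its completion is the only critical time left;
    by then every other job has missed its only possible start. *)
Lemma last_step st p c : sound C st -> leading st p c -> p.+1 = N ->
  over (step chi rule C st).
Proof.
move=> snd [/andP[cp pN] lc nol [ck stE fin]] p1N.
have cL : c = L.
  apply/eqP; rewrite eqn_leq leader_le //= leqNgt; apply/negP => cL.
  by have := nol L; rewrite leaderL => /(_ _)/negP; apply=> //; lia.
have [i0 i0c] := exists_index (leq_ltn_trans cp pN).
have start0 : start st i0 = Some (rel c) by rewrite stE i0c eqxx.
have relp (i : I) : rel i <= clock st.
  by rewrite ck release_le; have := lt_size_mkseq i; lia.
have := next_criticalP st; rewrite /step; case E: (next_critical st) => [t|]; last first.
  have [_ h _ _] := snd.1 _ _ start0.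
  move/(_ (rel c + len (job_at i0))); rewrite leNgt h => H.
  suff: false by []; apply: H.
  by apply/critical_candidatesP; right; exists i0, (rel c).
move=> [tC ct _].
have tE : t = rel c + len (J c).
  case/critical_candidatesP: tC => [[i]|[i [s []]]].
    by rewrite job_at_mkseq => ti; have := relp i; rewrite -ti leNgt ct.
  by rewrite stE job_at_mkseq; case: eqP => // -> [->].
have sel : selected chi rule C st t = finset.set0.
  apply/eqP; rewrite -finset.subset0; apply/fintype.subsetP => i.
  move/(fintype.subsetP (selected_feasible chi rule C st t)) => iF; exfalso.
  have [iL|iL] := eqVneq (i : nat) L; last first.
    move: iF; apply/negP; apply: idle_tight_infeasible => //.
      by rewrite stE cL (negbTE iL).
    exact: le_lt_trans (relp i) ct.
  move: iF; rewrite inE => /and3P[_ _]; rewrite finset.in_setU finset.in_set.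
  have Es : start st i = Some (rel c) by rewrite stE iL cL eqxx.
  by rewrite (progress_ge1 len_at_gt0 _ Es) job_at_mkseq iL -cL tE lexx orbT.
split=> [i|q qN|] /=; first by rewrite sel finset.in_set0.
  by apply: (le_trans _ (ltW ct)); rewrite ck release_le; lia.
rewrite /finished_at fin finset.set0U; apply/fintype.subsetP => i; rewrite !finset.in_set.
case Es: (start st i) => [s|]; last by rewrite /progress Es ler10.
by move: Es; rewrite stE; case: eqP => // ->; rewrite cL eqxx.
Qed.

Lemma over_step st : over st -> over (step chi rule C st).
Proof.
move=> [idle old fin]; rewrite /step; have := next_criticalP st.
case E: (next_critical st) => [t|] //.
case=> /critical_candidatesP[[i ti]|[i [s []]]]; last by rewrite idle.
by have := old i (lt_size_mkseq i); rewrite ti job_at_mkseq leNgt => /negbTE ->.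
Qed.

Lemma chain_states k : let st := iter k (@step R chi rule C theta) (init_state theta) in
  [\/ st = init_state theta, exists p c, leading st p c | over st].
Proof.
elim: k => [|k]; first by constructor 1.
have snd := sound_st chi C rule_opt len_at_gt0 k.
rewrite iterS; set st := iter k _ _ => -[stE|[p [c lead]]|ov].
- by constructor 2; exists 0%N, 0%N; apply: first_step.
- have [p1N|] := ltnP p.+1 N.
    by constructor 2; exists p.+1, (if leader p.+1 then p.+1 else c); apply: leading_step.
  move=> Np; constructor 3; have [/andP[_ pN] _ _ _] := lead.
  by apply: (last_step snd lead); lia.
- by constructor 3; apply: over_step.
Qed.

Lemma chain_welfare_le :
  welfare (GammaD_allocation chi rule C (theta := theta)) <= value (J L).
Proof.
have [iL iLE] := exists_index L_lt.
have -> : value (J L) = \sum_(i : I | i == iL) value (job_at i).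
  by rewrite big_pred1_eq job_at_mkseq iLE.
rewrite /welfare big_mkcond [leRHS]big_mkcond; apply: ler_sum => i _.
case: asboolP => [compl|_]; last by case: ifP => // _; rewrite ltW.
have [k iF] := completed_finished chi_gt1 rule_opt release_at_ge0 demand_at_gt0
  len_at_gt0 compl.
rewrite ifT // -(inj_eq val_inj) /= iLE; move: iF; rewrite /st_.
case: (chain_states k) => [->|[p [c [_ _ _ [_ _ ->]]]]|[_ _ /fintype.subsetP h]];
  rewrite ?inE //.
by move/h; rewrite finset.in_set.
Qed.
End Chain.

(** * Bernoulli's inequality and a geometric sum *)

Lemma bernoulli (R : realDomainType) (h : R) k :
  -1 <= h -> 1 + k%:R * h <= (1 + h) ^+ k.
Proof.
move=> h1; elim: k => [|k IH]; first by rewrite mul0r addr0.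
rewrite exprS; have h2 : 0 <= 1 + h by lra.
apply: (le_trans _ (ler_wpM2l h2 IH)); rewrite -natr1.
have : 0 <= k%:R * (h * h) by rewrite mulr_ge0 // -expr2 sqr_ge0.
by move: k%:R => K; nra.
Qed.

Lemma geometric_sum (R : realFieldType) (x : R) k :
  1 < x -> (x ^+ k - 1) / (1 - x^-1) = \sum_(i < k) x ^+ i.+1.
Proof.
move=> x1; elim: k => [|k IH]; first by rewrite big_ord0 expr0 subrr mul0r.
rewrite big_ord_recr /= -IH exprS {IH}; field.
by apply/andP; split; lra.
Qed.

(** * The worst-case instances *)

Section WorstCase.
(** [m] is the number of time units during which leaders replace each other, [eta] the margin that
    makes the comparisons of weights strict, and [eps] the spacing of the unit jobs at the end of
    each time unit. *)
Variables (R : realType) (chi : R) (kappa n m : nat) (eta eps : R).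
Hypothesis chi_gt1 : 1 < chi.
Hypothesis kappa_gt0 : (0 < kappa)%N.
Hypothesis n_gt0 : (0 < n)%N.
Hypothesis eta_bounds : 0 < eta < 1.
Hypothesis eps_gt0 : 0 < eps.
Hypothesis eps_small : n%:R * eps < 2^-1.

Let x : R := chi `^ (kappa%:R^-1).
(** Block [k] holds the [b] jobs released in [[k, k + 1)]. [L] opens block [m], and the last of the
    [N] jobs arrives just before [L] has run for [kappa] time units. *)
Let b := n.+2.
Let L := (m * b)%N.
Let N := ((m + kappa) * b)%N.

(** Positions 0 and 1 are half a unit apart; the other [n] crowd just before the end of the unit,
    where [x ^ t] is almost largest. *)
Definition offset a : R :=
  if a == 0%N then 0 else if a == 1%N then 2^-1 else 1 - (b - a)%:R * eps.

Definition instant p : R := (p %/ b)%N%:R + offset (p %% b)%N.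

Definition leader p := (p %% b < 2)%N && (p <= L)%N.

(* A leader overtakes the previous one half a time unit later, by a factor just
   above what Gamma_D gives to a running job; the last one is L. The other jobs
   always stay just below the running leader. Those at positions 2, ..., n + 1 of
   the blocks of b jobs form n chains of jobs spaced by one time unit, which can
   all be completed offline. *)
Definition worst_job p : job R :=
  if leader p then
    Job (instant p)
      (if p == L then (m + kappa).+1%:R + kappa%:R else instant p + kappa%:R)
      n kappa%:R ((1 + eta) ^+ p * x `^ instant p)
  else Job (instant p) (instant p + 1) 1 1 ((1 - eta) * x `^ instant p).

Let chi_gt0 : 0 < chi. Proof. exact: lt_trans chi_gt1. Qed.
Let x_gt0 : 0 < x. Proof. exact: powR_gt0. Qed.

Let x_gt1 : 1 < x.
Proof. by rewrite gt1_powR // invr_gt0 ltr0n. Qed.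

Let kappa_ge1 : 1 <= kappa%:R :> R. Proof. by rewrite ler1n. Qed.

Lemma offset_late a : (1 < a < b)%N ->
  [/\ 2^-1 < offset a, offset a >= 1 - n%:R * eps & offset a < 1].
Proof.
move=> /andP[a1 ab].
have -> : offset a = 1 - (b - a)%:R * eps.
  by case: a a1 {ab} => [|[|a]].
have h1 : 1 * eps <= (b - a)%:R * eps.
  by rewrite ler_wpM2r ?(ltW eps_gt0) // ler1n subn_gt0.
have h2 : (b - a)%:R * eps <= n%:R * eps.
  by rewrite ler_wpM2r ?(ltW eps_gt0) // ler_nat leq_subLR -[b]/(2 + n)%N leq_add2r.
move: (_%:R * eps) h1 h2 => u h1; move: (n%:R * eps) eps_small => v v2 uv.
by have := eps_gt0; split; lra.
Qed.

Lemma offset_bounds a : (a < b)%N -> 0 <= offset a < 1.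
Proof.
case: a => [|[|a]] ab; try by rewrite /offset /=; lra.
by have [h _ ->] := @offset_late a.+2 ab; rewrite andbT; lra.
Qed.

Lemma offset_inc a : (a.+1 < b)%N -> offset a < offset a.+1.
Proof.
case: a => [|[|a]] ab; first by rewrite /offset /=; lra.
  by have [h _ _] := @offset_late 2 ab; rewrite {1}/offset /=; lra.
rewrite /offset /= -(subnSK (ltnW ab)) -natr1; move: _%:R => u.
by have := eps_gt0; lra.
Qed.

Lemma instant_block k a : (a < b)%N -> instant (k * b + a)%N = k%:R + offset a.
Proof.
move=> ab.
by rewrite /instant divnMDl // modnMDl divn_small // modn_small // addn0.
Qed.

Lemma instant_inc p q : (p < q)%N -> instant p < instant q.
Proof.
apply: (homo_ltn (f := instant) (r := fun u v : R => u < v)) => [v u w|{}p].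
  exact: lt_trans.
have ab : (p %% b < b)%N by rewrite ltn_mod.
rewrite {2}(divn_eq p b) -addnS; have [lt_b|] := ltnP (p %% b).+1 b.
  by rewrite instant_block // /instant ltrD2l offset_inc.
move=> le_b; have -> : ((p %% b).+1 = b)%N by apply/eqP; rewrite eqn_leq ab.
rewrite addnC -mulSn -[(_ * b)%N]addn0 instant_block // /offset eqxx -natr1.
by rewrite /instant addr0 ltrD2l; case/andP: (offset_bounds ab).
Qed.

Lemma instant_le p q : (p <= q)%N -> instant p <= instant q.
Proof. by rewrite leq_eqVlt => /orP[/eqP->//|/instant_inc/ltW]. Qed.

Lemma instant_bounds p : (p %/ b)%N%:R <= instant p < (p %/ b)%N%:R + 1.
Proof.
have /offset_bounds /andP[h1 h2] : (p %% b < b)%N by rewrite ltn_mod.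
by rewrite /instant; lra.
Qed.

Lemma instant_ge0 p : 0 <= instant p.
Proof. by apply: le_trans (proj1 (andP (instant_bounds p))). Qed.

Lemma instant_lt_end p : (p < N)%N -> instant p < (m + kappa)%:R.
Proof.
move=> pN; have /andP[_ h] := instant_bounds p; apply: (lt_le_trans h).
by rewrite natr1 ler_nat ltn_divLR.
Qed.

Lemma instantL : instant L = m%:R.
Proof. by rewrite /L -[(m * b)%N]addn0 instant_block // /offset eqxx addr0. Qed.

Lemma leader_start k a : (a < 2)%N -> (k * b + a <= L)%N -> leader (k * b + a)%N.
Proof.
move=> a2 kL; rewrite /leader kL andbT modnMDl modn_small //; exact: leq_trans a2 _.
Qed.

Lemma leaderL : leader L.
Proof. by rewrite /L -[(m * b)%N]addn0 leader_start // addn0. Qed.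

(** A leader before [L] is followed by the next one after half a unit, and [kappa >= 1]; all
    releases after [L] precede [m + kappa]. *)
Lemma relay_in_time c p : leader c -> (c < p < N)%N ->
  (forall q, (c < q < p)%N -> ~~ leader q) -> instant p < instant c + kappa%:R.
Proof.
move=> lc /andP[cp pN] nol; case/andP: (lc) => a2 cL.
move: cL; rewrite leq_eqVlt => /orP[/eqP->|cL].
  by rewrite instantL -natrD instant_lt_end.
have no q : leader q -> (c < q)%N -> (p <= q)%N.
  move=> lq cq; rewrite leqNgt; apply/negP => qp.
  by have := nol q; rewrite cq qp lq => /(_ isT).
set k := (c %/ b)%N; have cE := divn_eq c b; rewrite -/k in cE.
case: (c %% b)%N a2 cE => [|[|//]] _ cE.
  have /instant_le : (p <= k * b + 1)%N.
    by apply: no; rewrite ?leader_start // addn1 -[(k * b)%N]addn0 -cE.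
  rewrite instant_block // cE instant_block // /offset /=.
  by move: k%:R => u; have := kappa_ge1; lra.
have km : (k < m)%N.
  by rewrite -(ltn_pmul2r (isT : 0 < b)%N) (leq_ltn_trans _ cL) // cE leq_addr.
have /instant_le : (p <= k.+1 * b + 0)%N.
  apply: no; last by rewrite cE addn0 mulSn addnC ltn_add2r.
  by apply: leader_start; rewrite // addn0 leq_mul2r km orbT.
rewrite instant_block // cE instant_block // /offset /= -natr1.
by move: k%:R => u; have := kappa_ge1; lra.
Qed.

Let powxD u v : x `^ (u + v) = x `^ u * x `^ v.
Proof. exact: gt0_powRD. Qed.

(** The boost of a leader of length [kappa] follows the growth of [x ^ t], so comparing weights
    reduces to comparing the factors in [eta]. *)
Lemma boosted_leader c p :
  (1 + eta) ^+ c * x `^ instant c * chi `^ ((instant p - instant c) / kappa%:R) =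
  (1 + eta) ^+ c * x `^ instant p.
Proof. by rewrite [_ / _]mulrC powRrM -/x -mulrA -powxD [instant c + _]addrC subrK. Qed.

Lemma release_worst p : release (worst_job p) = instant p.
Proof. by rewrite /worst_job; case: ifP. Qed.

Lemma value_worst_gt0 p : 0 < value (worst_job p).
Proof.
by rewrite /worst_job; case: ifP => _ /=;
  rewrite mulr_gt0 ?powR_gt0 ?exprn_gt0 //; have := eta_bounds; lra.
Qed.

Lemma len_worst p : 1 <= len (worst_job p) <= kappa%:R.
Proof. by rewrite /worst_job; case: ifP => _ /=; rewrite lexx ?andbT. Qed.

Lemma demand_worst p : (0 < demand (worst_job p) <= n)%N.
Proof. by rewrite /worst_job; case: ifP => _ /=; rewrite n_gt0 // leqnn. Qed.

Lemma L_ltN : (L < N)%N.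
Proof. by rewrite ltn_pmul2r // -[ltnLHS]addn0 ltn_add2l. Qed.

Lemma worst_welfare (rule : selection_rule R) : knapsack_optimal rule ->
  welfare (GammaD_allocation chi rule n (theta := mkseq worst_job N))
  <= (1 + eta) ^+ L * x ^+ m.
Proof.
move=> rule_opt.
have -> : (1 + eta) ^+ L * x ^+ m = value (worst_job L).
  by rewrite /worst_job leaderL instantL powR_mulrn // ltW.
apply: (@chain_welfare_le R chi rule n chi_gt1 rule_opt worst_job N L leader) => //.
- by move=> p; rewrite release_worst instant_ge0.
- by move=> p q pq; rewrite !release_worst instant_inc.
- by move=> p; case/andP: (len_worst p) => h _; apply: lt_le_trans h.
- exact: value_worst_gt0.
- exact: demand_worst.
- by move=> p lp; rewrite /worst_job lp.
- exact: leaderL.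
- by move=> p /andP[].
- exact: L_ltN.
- by move=> p pL; rewrite /worst_job; case: ifP => //= _; rewrite (negbTE pL).
- by rewrite /worst_job leaderL eqxx /= instantL lerD2r ler_nat leqW ?leq_addr.
- move=> c p lc cp nol; rewrite !release_worst /worst_job lc.
  exact: relay_in_time lc cp nol.
- move=> c p lc lp cp; rewrite !release_worst /worst_job lc lp /= boosted_leader.
  rewrite ltr_pM2r ?powR_gt0 // ltr_eXn2l //; have := eta_bounds; lra.
- move=> c p lc lp cp; rewrite !release_worst /worst_job lc (negbTE lp) /=.
  rewrite boosted_leader ltr_pM2r ?powR_gt0 //.
  have : 1 <= (1 + eta) ^+ c by apply: exprn_ege1; have := eta_bounds; lra.
  by have := eta_bounds; lra.
Qed.

Lemma worst_bounded : bounded_instances kappa n n (mkseq worst_job N).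
Proof.
split=> // [i|].
  rewrite /valid_job !job_at_mkseq release_worst instant_ge0 len_worst value_worst_gt0.
  by case/andP: (demand_worst i) => ->.
apply/eqP; rewrite eqn_leq; apply/andP; split.
  by apply/bigmax_leqP => i _; rewrite job_at_mkseq; case/andP: (demand_worst i).
have [i iL] := exists_index worst_job L_ltN.
apply: leq_trans (leq_bigmax i); rewrite job_at_mkseq iL /worst_job leaderL //.
Qed.

(** [L] is postponed until all unit jobs are over, which its late deadline permits; the other jobs
    at positions 0 and 1 are given up. *)
Definition worst_schedule : allocation (mkseq worst_job N) := fun t i =>
  if (1 < i %% b)%N then nat_of_bool (instant i <= t < instant i + 1)
  else if (i == L :> nat) && (((m + kappa).+1%:R : R) <= t) then n else 0%N.

Lemma worst_schedule_feasible : feasible_allocation n worst_schedule.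
Proof.
move=> t t0; have [late|early] := leP (m + kappa).+1%:R t.
  have [iL iLE] := exists_index worst_job L_ltN.
  rewrite (bigD1 iL) //= big1 ?addn0 => [|i].
    by rewrite /worst_schedule iLE modnMl eqxx late.
  rewrite -(inj_eq val_inj) /= iLE /worst_schedule => /negbTE->.
  case: ifP => // _; rewrite [_ <= t < _]andbC ltNge.
  have := instant_lt_end (lt_size_mkseq i); move: late; rewrite -natr1 => h1 h2.
  by rewrite (_ : instant i + 1 <= t) //; lra.
pose A := [set i : 'I_(size (mkseq worst_job N)) |
  (1 < i %% b)%N && (instant i <= t < instant i + 1)%R].
have -> : (\sum_i worst_schedule t i = #|A|)%N.
  rewrite -sum1_card [RHS]big_mkcond /=; apply: eq_bigr => i _.
  rewrite /worst_schedule finset.in_set [_.+1%:R <= t]leNgt early andbF.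
  by case: ifP => //= _; case: (_ <= t < _).
rewrite cardE -(size_map (fun i : 'I_(size (mkseq worst_job N)) => (i %% b - 2)%N)).
rewrite -[leqRHS](size_iota 0).
(* Jobs at the same position of different blocks are released at least one unit apart, so the jobs
   running at [t] occupy distinct positions among [n]. *)
apply: uniq_leq_size => [|_ /mapP[i _ ->]]; last first.
  rewrite mem_iota /=; have : (i %% b < b)%N by rewrite ltn_mod.
  by move: (i %% b)%N n_gt0; rewrite /b; clear; lia.
rewrite map_inj_in_uniq ?enum_uniq // => i j; rewrite !mem_enum !finset.in_set.
move=> /andP[i1 /andP[it ti]] /andP[j1 /andP[jt tj]] ij.
have {}ij : (i %% b = j %% b)%N.
  by move: i1 j1 ij; move: (i %% b)%N (j %% b)%N; clear; lia.
have le_div (p q : nat) : (p %% b = q %% b)%N -> instant p <= t ->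
    t < instant q + 1 -> (p %/ b <= q %/ b)%N.
  rewrite /instant => -> h1 h2; rewrite leqNgt; apply/negP => qp.
  have : (q %/ b)%N%:R + 1 <= (p %/ b)%N%:R :> R by rewrite natr1 ler_nat.
  by move: h1 h2; lra.
apply: val_inj => /=; rewrite (divn_eq i b) (divn_eq j b) ij; congr (_ * _ + _)%N.
by apply/eqP; rewrite eqn_leq !le_div.
Qed.

(** Each of the [n] unit jobs of block [k] is released no earlier than [k + 1 - n * eps]. *)
Lemma worst_chain_value k :
  n%:R * ((1 - eta) * x `^ (- (n%:R * eps)) * x ^+ k.+1) <=
  \sum_(k * b <= p < k.+1 * b | (1 < p %% b)%N) value (worst_job p).
Proof.
rewrite (big_cat_nat (n := (k * b + 2)%N)) /=; last first.
- by rewrite mulSn addnC leq_add2r.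
- by rewrite leq_addr.
rewrite -[leLHS]add0r lerD //.
  by apply: sumr_ge0 => p _; rewrite ltW ?value_worst_gt0.
rewrite big_mkcond /= mulr_natl.
rewrite [X in _ *+ X](_ : n = k.+1 * b - (k * b + 2))%N; last first.
  by rewrite mulSn [(b + _)%N]addnC subnDl subn2.
rewrite -sumr_const_nat; apply: ler_sum_nat => p /andP[kp pk].
have [a2 pE] : (1 < p - k * b < b)%N /\ p = (k * b + (p - k * b))%N.
  by move: kp pk; rewrite mulSn; move: (k * b)%N b; clear; lia.
have [a1 ab] := andP a2; rewrite pE modnMDl modn_small // a1.
rewrite /worst_job /leader modnMDl modn_small // ltnNge a1 /=.
rewrite -mulrA ler_pM2l; last by have := eta_bounds; lra.
rewrite -powR_mulrn ?(ltW x_gt0) // -powxD instant_block //.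
have [_ h _] := offset_late a2; apply: ler_powR; first exact: ltW.
by rewrite -natr1 addrCA lerD2l addrC.
Qed.

Lemma worst_OPT :
  (1 + eta) ^+ L * x ^+ m +
  n%:R * ((1 - eta) * x `^ (- (n%:R * eps)) * ((x ^+ m * chi - 1) / (1 - x^-1)))
  <= OPT n (mkseq worst_job N).
Proof.
apply: (@le_trans _ _ (welfare worst_schedule)); last first.
  apply: ub_le_sup; last by exists worst_schedule => //; apply: worst_schedule_feasible.
  exists (\sum_(i < size (mkseq worst_job N)) value (job_at i)) => _ [a _ ->].
  rewrite /welfare big_mkcond; apply: ler_sum => i _; case: ifP => // _.
  by rewrite job_at_mkseq ltW ?value_worst_gt0.
have compl (i : 'I_(size (mkseq worst_job N))) : (1 < i %% b)%N ->
    completed_in worst_schedule i.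
  move=> i1; exists (instant i); rewrite !job_at_mkseq /worst_job /leader ltnNge i1 /=.
  by split=> // t h; rewrite /worst_schedule i1 h.
have complL (i : 'I_(size (mkseq worst_job N))) : i = L :> nat ->
    completed_in worst_schedule i.
  move=> iL; exists (m + kappa).+1%:R.
  rewrite !job_at_mkseq iL /worst_job leaderL eqxx /=.
  split=> // [|t /andP[h _]]; first by rewrite instantL ler_nat leqW ?leq_addr.
  by rewrite /worst_schedule iL modnMl eqxx h.
have [iL iLE] := exists_index worst_job L_ltN.
rewrite /welfare (bigID (fun i => i == iL)) /=; apply: lerD.
  rewrite (big_pred1 iL) => [|i]; last first.
    apply/andP/eqP => [[_ /eqP]//|->]; rewrite eqxx; split=> //.
    exact/asboolP/complL.
  by rewrite job_at_mkseq iLE /worst_job leaderL instantL powR_mulrn // ltW.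
apply: (@le_trans _ _
  (\sum_(0 <= p < N | (1 < p %% b)%N) value (worst_job p))); last first.
  rewrite -{1}(size_mkseq worst_job N) big_mkord big_mkcond [leRHS]big_mkcond.
  apply: ler_sum => i _; rewrite job_at_mkseq; case: ifP => i1; last first.
    by case: ifP => // _; rewrite ltW ?value_worst_gt0.
  rewrite ifT //; apply/andP; split; first exact/asboolP/compl.
  by rewrite -(inj_eq val_inj) /= iLE; apply: contraTneq i1 => ->; rewrite modnMl.
rewrite big_mkcond /= big_nat_mul big_mkord.
(* As [x ^+ kappa = chi], the [m + kappa] blocks give a full geometric sum. *)
have -> : x ^+ m * chi = x ^+ (m + kappa).
  rewrite exprD -[x ^+ kappa]powR_mulrn ?(ltW x_gt0) // -powRrM.
  rewrite mulVf ?powRr1 ?(ltW chi_gt0) //.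
  by rewrite pnatr_eq0 -lt0n.
rewrite geometric_sum // !mulr_sumr; apply: ler_sum => k _.
by rewrite -big_mkcond; apply: worst_chain_value.
Qed.
End WorstCase.

(** * Choice of the parameters *)

Lemma exists_expr_gt (R : realType) (x y : R) : 1 < x -> exists m, y < x ^+ m.
Proof.
move=> x1; have d0 : 0 < x - 1 by lra.
exists (Num.bound (`|y| / (x - 1))); rewrite -[x in x ^+ _](subrKC 1).
apply: lt_le_trans (bernoulli _ _); last by lra.
have : `|y| / (x - 1) < (Num.bound (`|y| / (x - 1)))%:R.
  by apply: archi_boundP; rewrite divr_ge0 // ltW.
by rewrite ltr_pdivrMr // => h; have := ler_norm y; lra.
Qed.

Lemma powR_opp_ge (R : realType) (x u : R) : 0 < x -> 1 - u * ln x <= x `^ (- u).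
Proof.
move=> x0; rewrite /powR gt_eqF // mulNr; exact: expR_ge1Dx.
Qed.

(** Relative to [x ^+ m], the offline surplus tends to [A]. The gap between [c] and [A + 1] is spent
    first on [m] and then, with [m] fixed, on [eta] and [eps]. The maximum with 0 keeps the factor
    nonnegative, so that it can multiply an upper bound on the welfare. *)
Lemma exists_parameters (R : realType) (chi c : R) (kappa n : nat) :
  1 < chi -> (0 < kappa)%N -> (0 < n)%N ->
  c < n%:R * (chi / (1 - (chi `^ kappa%:R^-1)^-1)) + 1 ->
  exists m eta eps, [/\ 0 < eta < 1, 0 < eps, n%:R * eps < 2^-1 &
    Num.max c 0 * ((1 + eta) ^+ (m * n.+2) * (chi `^ kappa%:R^-1) ^+ m) <
    (1 + eta) ^+ (m * n.+2) * (chi `^ kappa%:R^-1) ^+ m +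
    n%:R * ((1 - eta) * (chi `^ kappa%:R^-1) `^ (- (n%:R * eps)) *
      (((chi `^ kappa%:R^-1) ^+ m * chi - 1) / (1 - (chi `^ kappa%:R^-1)^-1)))].
Proof.
move=> chi1 k0 n0.
have : 1 < chi `^ kappa%:R^-1 by rewrite gt1_powR // invr_gt0 ltr0n.
move: (chi `^ _) => x x1 c_lt.
have n1 : 0 < n%:R :> R by rewrite ltr0n.
have q1 : 0 < 1 - x^-1 by rewrite subr_gt0 invf_lt1 //; lra.
set A := n%:R * (chi / (1 - x^-1)) in c_lt.
have A0 : 0 < A by rewrite mulr_gt0 // divr_gt0 //; lra.
have [D [D0 DA cD]] : exists D, [/\ 0 <= D, D < A & Num.max c 0 <= D + 1].
  exists (Num.max (c - 1) 0); rewrite le_max lexx orbT gt_max A0 andbT; split=> //.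
    by lra.
  by rewrite ge_max -lerBlDr le_max lexx /= addr_ge0 // le_max lexx orbT.
(* The midpoint leaves half of the gap for the error term [A / chi], which a large [x ^+ m]
   absorbs. *)
pose D' := (A + D) / 2; have D'0 : 0 < D' by rewrite /D'; lra.
have [m mP] := exists_expr_gt (A / chi / (A - D')) x1.
have {mP} xm : D' * x ^+ m <= A * (x ^+ m - chi^-1).
  move: mP; rewrite ltr_pdivrMr; last by rewrite /D'; lra.
  by rewrite -[A / chi]/(A * chi^-1); lra.
(* A quarter of the relative gap allows two losses of a factor [1 - d], because
   [(1 - d) ^ 2 > 1 - 4 * d]. *)
pose d := (1 - D / D') / 4.
have dE : D = D' * (1 - 4 * d) by rewrite /d; field; rewrite gt_eqF.
have d0 : 0 < d by rewrite /d divr_gt0 // subr_gt0 ltr_pdivrMr // mul1r /D'; lra.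
have d1 : d <= 1 / 4.
  have : 0 <= D / D' by rewrite divr_ge0 // ltW.
  by rewrite /d; move: (D / D') => u; lra.
pose L := (m * n.+2)%N.
have L1 : 1 <= L.+1%:R :> R by rewrite ler1n.
have lnx : 0 < ln x by rewrite ln_gt0.
(* By Bernoulli [(1 - eta) ^+ L.+1 >= 1 - d]. The factor [1 + ln x] yields both [n * eps <= d] and
   [n * eps * ln x <= d]. *)
exists m, (d / L.+1%:R), (d / (n%:R * (1 + ln x))); rewrite -/L.
set eta := d / _; set eps := d / _.
have neps : n%:R * eps = d / (1 + ln x).
  by rewrite /eps; field; rewrite !gt_eqF //; lra.
have eta0 : 0 < eta by rewrite divr_gt0 //; lra.
have eta1 : eta <= d by rewrite ler_pdivrMr ?ler_peMr //; lra.
have neps1 : n%:R * eps <= d by rewrite neps ler_pdivrMr ?ler_peMr //; lra.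
split; [by lra|by rewrite divr_gt0 // mulr_gt0 //; lra|by lra|].
have E1 : 1 - d <= x `^ (- (n%:R * eps)).
  apply: le_trans (powR_opp_ge _ _); last by lra.
  rewrite lerD2l lerN2 neps mulrAC ler_pdivrMr; last by lra.
  by rewrite ler_pM2l //; lra.
have B1 : 1 - d <= (1 - eta) ^+ L.+1.
  apply: le_trans (bernoulli _ _); last by lra.
  by rewrite mulrN /eta mulrCA divff ?mulr1 //; lra.
set E := x `^ _ in E1 *.
have x0 : 0 < x ^+ m by rewrite exprn_gt0 //; lra.
have -> : n%:R * ((1 - eta) * E * ((x ^+ m * chi - 1) / (1 - x^-1))) =
    (1 - eta) * E * (A * (x ^+ m - chi^-1)).
  rewrite /A; field; apply/andP; split; lra.
set P := (1 + eta) ^+ L.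
have P0 : 0 < P by rewrite exprn_gt0 //; lra.
have Q0 : 0 < (1 - eta) ^+ L by rewrite exprn_gt0 //; lra.
(* Since [(1 + eta) * (1 - eta) <= 1], the growth [P] of the leaders' values is traded for [L] more
   factors [1 - eta]. *)
have PQ : P * (1 - eta) ^+ L <= 1.
  by rewrite -exprMn exprn_ile1 //; nra.
have main : D * P < D' * ((1 - eta) * E).
  rewrite -(ltr_pM2r Q0) -mulrA.
  apply: (le_lt_trans (ler_wpM2l D0 PQ)); rewrite mulr1.
  have -> : D' * ((1 - eta) * E) * (1 - eta) ^+ L = D' * ((1 - eta) ^+ L.+1 * E).
    by rewrite exprS; ring.
  rewrite dE ltr_pM2l //.
  apply: (@lt_le_trans _ _ ((1 - d) * (1 - d))); first by nra.
  by apply: ler_pM => //; lra.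
apply: (@le_lt_trans _ _ ((D + 1) * (P * x ^+ m))).
  by rewrite ler_wpM2r // mulr_ge0 // ltW.
rewrite mulrDl mul1r addrC ltrD2l mulrA.
apply: (@lt_le_trans _ _ (D' * ((1 - eta) * E) * x ^+ m)).
  by rewrite ltr_pM2r.
rewrite [leLHS]mulrC mulrA [x ^+ m * D']mulrC [leRHS]mulrC ler_wpM2r //.
by rewrite mulr_ge0 //; lra.
Qed.

(** * The two bounds combined *)

Theorem theorem4p2 (R : realType) (kappa nmax : nat) (chi : R)
    (rule : selection_rule R) (kappa_ge1 : (1 <= kappa)%N)
    (nmax_ge1 : (1 <= nmax)%N) (chi_gt1 : 1 < chi)
    (rule_opt : knapsack_optimal rule) :
  has_competitive_ratio (GammaD chi rule) (bounded_instances kappa nmax)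
    (nmax%:R * (chi / (1 - chi `^ (- kappa%:R^-1))) + 1).
Proof.
rewrite powRN; split.
  move=> [C [theta [[nC valid dem]]]]; apply/negP; rewrite -leNgt.
  have len0 (i : 'I_(size theta)) : 0 < len (job_at i).
    by have [_ _ /andP[h _] _] := valid i; apply: lt_le_trans h.
  have [N stuck] : exists N, next_critical (st_ chi rule C theta N) = None.
    exact: eventually_stuck.
  apply: (OPT_le _ _ _ _ _ _ _ _ _ nC stuck) => // i;
    have [r0 d0 /andP[l1 lk] v0] := valid i => //.
  by rewrite -dem; apply: leq_bigmax.
move=> c c_lt; apply.
have [m [eta [eps [eta_bounds eps_gt0 eps_small lt_opt]]]] :=
  exists_parameters chi_gt1 kappa_ge1 nmax_ge1 c_lt.
exists nmax, (mkseq (worst_job chi kappa nmax m eta eps) ((m + kappa) * nmax.+2)).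
split; first exact: worst_bounded.
apply: lt_le_trans (worst_OPT m chi_gt1 kappa_ge1 nmax_ge1 eta_bounds eps_gt0 eps_small).
apply: le_lt_trans lt_opt.
set W := welfare _.
have W0 : 0 <= W.
  apply: sumr_ge0 => i _; rewrite job_at_mkseq ltW //.
  exact: value_worst_gt0.
have Wle := worst_welfare m chi_gt1 kappa_ge1 nmax_ge1 eta_bounds eps_gt0 eps_small
  rule_opt.
apply: (@le_trans _ _ (Num.max c 0 * W)).
  by rewrite ler_wpM2r // le_max lexx.
by rewrite ler_wpM2l // le_max lexx orbT.
Qed.
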